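(* For $t=0,\dots,T$ let $M_t\succeq0$ ($n_x\times n_x$) and $N_t\succeq0$ ($n_z\times n_z$) be positive semidefinite matrices and $W_t\subseteq\mathbb R^{n_x}$, $V_t\subseteq\mathbb R^{n_z}$ nonempty polyhedral sets, and suppose that the independent random vectors $\mathbf W_t$ and $\mathbf V_t$ have densities proportional to $e^{-\rho_{W_t,M_t}}$ and $e^{-\rho_{V_t,N_t}}$ respectively. Let $F_0,\dots,F_{T-1}$ be real $n_x\times n_x$ matrices, $H_0,\dots,H_T$ real $n_z\times n_x$ matrices, and $z_0,\dots,z_T\in\mathbb R^{n_z}$. Then the maximum a posteriori problem $$\min_{x_0,\dots,x_T}\ \sum_{t=0}^T\rho_{W_t,M_t}(w_t)+\sum_{t=0}^T\rho_{V_t,N_t}(z_t-H_tx_t)\quad\text{s.t. } x_{t+1}=F_tx_t+w_{t+1}\ (t=0,\dots,T-1),\ \ x_0=w_0$$ is dual to the control problem $$\sup_{u_0,\dots,u_T}\ \sum_{t=0}^T\Big(z_t'u_t-\tfrac12y_t'M_ty_t-\tfrac12u_t'N_tu_t\Big)$$ $$\text{s.t. } y_t=F_t'y_{t+1}+H_t'u_t\ (t=0,\dots,T-1),\quad y_T=H_T'u_T,\quad y_t\in W_t,\ u_t\in V_t\ (t=0,\dots,T).$$ Optimal values are attained and strong duality holds (the two optimal values are equal) when either problem is feasible.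
   Context: Prime denotes transpose. For a nonempty polyhedral set $U\subseteq\mathbb R^n$ and a symmetric positive semidefinite $n\times n$ matrix $M$, the monitoring function is $\rho_{U,M}(x)=\sup_{u\in U}\{x'u-\tfrac12u'Mu\}$; $e^{-\infty}=0$. In the first problem, $w_0,\dots,w_T\in\mathbb R^{n_x}$ are determined by $x_0,\dots,x_T\in\mathbb R^{n_x}$ through the constraints; in the second, $y_0,\dots,y_T\in\mathbb R^{n_x}$ are determined by $u_0,\dots,u_T\in\mathbb R^{n_z}$ through the constraints. The first problem is the maximum a posteriori estimation problem for the system $\mathbf X_0=\mathbf W_0$, $\mathbf X_{t+1}=F_t\mathbf X_t+\mathbf W_{t+1}$, $\mathbf Z_t=H_t\mathbf X_t+\mathbf V_t$ given $\mathbf Z_t=z_t$ for all $t$, with additive constants from the normalization of the densities dropped. A problem is feasible if some point satisfies its constraints with finite objective value. Duality: $\min_{p\in C}h(p)$ and $\max_{q\in D}k(q)$ are dual via a convex-concave function $L:C\times D\to[-\infty,\infty]$ if $h(p)=\sup_{q\in D}L(p;q)$ for all $p\in C$ and $k(q)=\inf_{p\in C}L(p;q)$ for all $q\in D$, where constraints are incorporated by giving the objective the value $+\infty$ (minimization) or $-\infty$ (maximization) at points violating them. Here $p=(w,x)\in C=\mathbb R^{(T+1)n_x}\times\mathbb R^{(T+1)n_x}$, $q=(u,y)\in D=\mathbb R^{(T+1)n_z}\times\mathbb R^{(T+1)n_x}$, and, with $f_t=\rho_{W_t,M_t}$, $g_t=\rho_{V_t,N_t}$ and $g_t^*(u)=\sup_v\{v'u-g_t(v)\}$,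 $$L(w,x;u,y)=\sum_{t=0}^T\big(f_t(w_t)+z_t'u_t-g_t^*(u_t)-u_t'H_tx_t\big)+y_0'(x_0-w_0)+\sum_{t=0}^{T-1}y_{t+1}'(x_{t+1}-F_tx_t-w_{t+1}),$$ with the indeterminate expression $\infty-\infty$ assigned the value $+\infty$.
   Formalization: When only the control problem is known to be feasible, attainment of its optimal value is claimed only if that value is below +∞; if the estimation problem is infeasible both values are +∞, which no control attains (e.g. T=0, M=N=0, W=V=(−∞,1], H=1, z=−1). *)

(* Defs.v *)
From HB Require Import structures.
From mathcomp Require Import all_boot all_order all_algebra.
From mathcomp Require Import all_classical all_reals all_analysis.

Set Implicit Arguments.
Unset Strict Implicit.
Unset Printing Implicit Defensive.

Import Order.TTheory GRing.Theory Num.Theory.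
Local Open Scope classical_set_scope.
Local Open Scope ring_scope.

Section Vectors.
Context {R : realType} {n : nat}.
Implicit Types (x u : 'cV[R]_n) (M : 'M[R]_n) (U : set 'cV[R]_n).

Definition dot x u : R := (x^T *m u) 0 0.

Definition quad M u : R := dot u (M *m u).

Definition psd M : Prop := M^T = M /\ forall u, 0 <= quad M u.

(* A finite intersection of closed half-spaces [a_i' u <= b_i]. *)
Definition polyhedral U : Prop :=
  exists (m : nat) (A : 'M[R]_(m, n)) (b : 'cV[R]_m),
    U = [set u | forall i, (A *m u) i 0 <= b i 0].

Definition monitoring U M x : \bar R :=
  ereal_sup [set (dot x u - 2^-1 * quad M u)%:E | u in U].

Definition conjugate (g : 'cV[R]_n -> \bar R) u : \bar R :=
  ereal_sup [set ((dot v u)%:E - g v)%E | v in [set: 'cV[R]_n]].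

End Vectors.

Section Duality.
Context {R : realType}.

(* Convexity of an extended-real-valued function is convexity of its epigraph;
   this also covers functions taking the value -oo. *)
Definition econvex {E : lmodType R} (C : set E) (f : E -> \bar R) : Prop :=
  @convex_set R (E * R^o)%type
    [set pa : E * R^o | C pa.1 /\ (f pa.1 <= (pa.2 : R)%:E)%E].

Definition econcave {E : lmodType R} (C : set E) (f : E -> \bar R) : Prop :=
  econvex C (fun p => - f p)%E.

Definition convex_concave {E1 E2 : lmodType R} (C : set E1) (D : set E2)
    (L : E1 -> E2 -> \bar R) : Prop :=
  (forall q, D q -> econvex C (L^~ q)) /\ (forall p, C p -> econcave D (L p)).

Definition dual_via {E1 E2 : lmodType R} (C : set E1) (D : set E2)
    (h : E1 -> \bar R) (k : E2 -> \bar R) (L : E1 -> E2 -> \bar R) : Prop :=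
  [/\ convex_concave C D L,
      forall p, C p -> h p = ereal_sup [set L p q | q in D] &
      forall q, D q -> k q = ereal_inf [set L p q | p in C]].

End Duality.

Section LebesgueTuple.
Context {R : realType}.
Local Notation mR := (measurableTypeR R).

Definition tuple_cons {n} (p : mR * n.-tuple mR) : n.+1.-tuple mR :=
  [tuple of p.1 :: p.2].

Section tuple_cons_measure.
Context {n : nat} (mu : {sigma_finite_measure set (n.-tuple mR) -> \bar R}).

Lemma measurable_tuple_cons :
  measurable_fun [set: mR * n.-tuple mR] (@tuple_cons n).
Proof. exact: measurable_cons. Qed.

Definition cons_measure : set (n.+1.-tuple mR) -> \bar R :=
  pushforward (@lebesgue_measure R \x mu)%E (@tuple_cons n).

Let cons_measure0 : cons_measure set0 = 0%E.
Proof. by rewrite /cons_measure /pushforward preimage_set0 measure0. Qed.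

Let cons_measure_ge0 A : (0 <= cons_measure A)%E.
Proof. by rewrite /cons_measure /pushforward measure_ge0. Qed.

Let cons_measure_sigma_additive : semi_sigma_additive cons_measure.
Proof.
apply: measure_semi_sigma_additive; exact: measurable_tuple_cons.
Qed.

HB.instance Definition _ := isMeasure.Build _ _ _ cons_measure
  cons_measure0 cons_measure_ge0 cons_measure_sigma_additive.

Let cons_measure_sigma_finite : sigma_finite setT cons_measure.
Proof.
have /sigma_finiteP[F [TF ndF Foo]] := sigma_finiteT (@lebesgue_measure R).
have /sigma_finiteP[G [TG ndG Goo]] := sigma_finiteT mu.
pose g (v : n.+1.-tuple mR) : mR * n.-tuple mR :=
  (thead v, [tuple of behead v]).
have mg : measurable_fun [set: n.+1.-tuple mR] g.
  by apply/measurable_fun_pairP; split;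
    [exact: measurable_tnth|exact: measurable_behead].
have gK : cancel tuple_cons g.
  by move=> [x v]; rewrite /g /tuple_cons; congr pair; exact/val_inj.
exists (fun k => g @^-1` (F k `*` G k)).
  rewrite -preimage_bigcup (_ : \bigcup_k _ = setT) ?preimage_setT//.
  rewrite -setXTT TF TG predeqE => -[x y]; split.
    by move=> [k _ []/= ? ?]; split; exists k.
  move=> [/= [k _ Fkx] [l _ Gly]]; exists (maxn k l) => //; split.
  - by move: x Fkx; exact/subsetPset/ndF/leq_maxl.
  - by move: y Gly; exact/subsetPset/ndG/leq_maxr.
move=> k; have [mF Fk] := Foo k; have [mG Gk] := Goo k; split.
  by rewrite -[X in measurable X]setTI; apply: mg => //; exact: measurableX.
rewrite /cons_measure /pushforward -comp_preimage.
rewrite (_ : g \o tuple_cons = id) ?preimage_id; last exact/funext.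
by rewrite product_measure1E// lte_mul_pinfty// ge0_fin_numE.
Qed.

HB.instance Definition _ := Measure_isSigmaFinite.Build _ _ _ cons_measure
  cons_measure_sigma_finite.

End tuple_cons_measure.

Fixpoint lebesgue_tuple n : {sigma_finite_measure set (n.-tuple mR) -> \bar R} :=
  match n with
  | 0 => \d_([tuple] : 0.-tuple mR)
  | n.+1 => cons_measure (lebesgue_tuple n)
  end.

End LebesgueTuple.

Section RandomVectors.
Context {R : realType} {d : measure_display} {Omega : measurableType d}.
Context (P : probability Omega R).
Local Notation mR := (measurableTypeR R).

(* Random vectors take values in tuples, which carry the Borel sigma-algebra;
   densities are functions on column vectors. *)
Definition vec_of_tuple {n} (v : n.-tuple mR) : 'cV[R]_n := \col_i tnth v i.

Definition density_proportional_to {n} (X : {RV P >-> n.-tuple mR})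
    (g : 'cV[R]_n -> \bar R) : Prop :=
  exists2 c : R, 0 < c & forall A, measurable A ->
    distribution P X A =
      (\int[lebesgue_tuple n]_(v in A) (c%:E * g (vec_of_tuple v)))%E.

Definition independent_vectors {I J : finType} {m n}
    (X : I -> {RV P >-> m.-tuple mR})
    (Y : J -> {RV P >-> n.-tuple mR}) : Prop :=
  forall (A : I -> set (m.-tuple mR)) (B : J -> set (n.-tuple mR)),
    (forall i, measurable (A i)) -> (forall j, measurable (B j)) ->
    P ((\bigcap_i (X i @^-1` A i)) `&` (\bigcap_j (Y j @^-1` B j))) =
      (\prod_i P (X i @^-1` A i) * \prod_j P (Y j @^-1` B j))%E.

End RandomVectors.

Section Problems.
Context {R : realType} {T nx nz : nat}.
Context (M : 'I_T.+1 -> 'M[R]_nx) (N : 'I_T.+1 -> 'M[R]_nz).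
Context (W : 'I_T.+1 -> set 'cV[R]_nx) (V : 'I_T.+1 -> set 'cV[R]_nz).
Context (F : 'I_T -> 'M[R]_nx) (H : 'I_T.+1 -> 'M[R]_(nz, nx)).
Context (z : 'I_T.+1 -> 'cV[R]_nz).

Definition trajectory n : lmodType R := 'I_T.+1 -> 'cV[R]_n.

(* The times t and t+1 in {0, ..., T}, for t in {0, ..., T-1}. *)
Definition time_cur (t : 'I_T) : 'I_T.+1 := widen_ord (leqnSn T) t.
Definition time_succ (t : 'I_T) : 'I_T.+1 := lift ord0 t.

(* A point of the estimation problem is p = (w, x). *)
Definition map_constraints (p : trajectory nx * trajectory nx) : Prop :=
  let: (w, x) := p in
  (forall t, x (time_succ t) = F t *m x (time_cur t) + w (time_succ t)) /\
  x ord0 = w ord0.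

Definition map_cost (p : trajectory nx * trajectory nx) : \bar R :=
  let: (w, x) := p in
  (\sum_(t < T.+1) monitoring (W t) (M t) (w t) +
   \sum_(t < T.+1) monitoring (V t) (N t) (z t - H t *m x t))%E.

Definition map_objective p : \bar R :=
  if `[< map_constraints p >] then map_cost p else +oo%E.

Definition map_feasible : Prop :=
  exists2 p, map_constraints p & map_cost p \is a fin_num.

Definition map_value : \bar R := ereal_inf (range map_objective).

Definition map_attained : Prop :=
  exists2 p, map_constraints p & map_cost p = map_value.

(* A point of the control problem is q = (u, y). *)
Definition control_constraints (q : trajectory nz * trajectory nx) : Prop :=
  let: (u, y) := q in
  [/\ forall t, y (time_cur t) =
        (F t)^T *m y (time_succ t) + (H (time_cur t))^T *m u (time_cur t),
      y ord_max = (H ord_max)^T *m u ord_max &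
      forall t, W t (y t) /\ V t (u t)].

Definition control_reward (q : trajectory nz * trajectory nx) : R :=
  let: (u, y) := q in
  \sum_(t < T.+1)
    (dot (z t) (u t) - 2^-1 * quad (M t) (y t) - 2^-1 * quad (N t) (u t)).

Definition control_objective q : \bar R :=
  if `[< control_constraints q >] then (control_reward q)%:E else -oo%E.

(* [control_reward] is real-valued, so a point satisfying the constraints
   always has a finite objective value. *)
Definition control_feasible : Prop := exists q, control_constraints q.

Definition control_value : \bar R := ereal_sup (range control_objective).

Definition control_attained : Prop :=
  exists2 q, control_constraints q & (control_reward q)%:E = control_value.

(* In [ereal_dual_scope], +oo + -oo = +oo. *)
Definition lagrangian (p : trajectory nx * trajectory nx)
    (q : trajectory nz * trajectory nx) : \bar R :=
  let: (w, x) := p in let: (u, y) := q in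
  (\sum_(t < T.+1)
     (monitoring (W t) (M t) (w t) + (dot (z t) (u t))%:E
      - conjugate (monitoring (V t) (N t)) (u t)
      - (dot (u t) (H t *m x t))%:E) +
   (dot (y ord0) (x ord0 - w ord0))%:E +
   \sum_(t < T)
     (dot (y (time_succ t))
          (x (time_succ t) - F t *m x (time_cur t) - w (time_succ t)))%:E)%dE.

End Problems.

(* Main.v *)
Require Import Defs.
From HB Require Import structures.
From mathcomp Require Import all_boot all_order all_algebra.
From mathcomp Require Import all_classical all_reals all_analysis.
From mathcomp Require Import measurable_realfun ring lra.

(* Substituting the definition of the monitoring functions, the control problem is
   a concave quadratic program over a polyhedron, with the adjoint dynamics as
   linear equality constraints, and the Lagrangian is the one obtained by pricing
   these constraints with the states [x]. Integrability of the densities forces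
   [0] into every [W_t] and [V_t] (otherwise some translation would multiply the
   integral of the density by a factor above [1]), so the control problem is always
   feasible and, by weak duality, it is bounded as soon as the estimation problem
   is feasible. A bounded feasible quadratic program attains its maximum
   (Frank-Wolfe), and its Karush-Kuhn-Tucker multipliers for the dynamics are the
   states of an optimal solution of the estimation problem. *)

Set Implicit Arguments.
Unset Strict Implicit.
Unset Printing Implicit Defensive.

Import Order.TTheory GRing.Theory Num.Theory.
Local Open Scope classical_set_scope.
Local Open Scope ring_scope.

(** * Concave quadratic programs over polyhedra *)

(** Only the dynamics are priced. The conditions that [y t] lies in [W t] and [u t] in [V t] stay as
    side conditions of the saddle inequality, because the monitoring functions are suprema over
    exactly these sets: taking the supremum over [y] and [u] in that inequality rebuilds the
    estimation cost. Polyhedrality takes the place of an interior-point qualification. Multipliers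
    come from projecting the gradient onto the cone of active constraints, and this projection is
    itself a concave quadratic program over a polyhedron, so the attainment theorem is proved once
    and used twice. Infinite values shape the duality part. With [+oo - oo] read as [+oo], an
    infinite monitoring value at [w] makes the Lagrangian [+oo] whatever [u] is; the arguments
    therefore split on [w] first, then on membership of [u] in [V], and only then compute in the
    reals. The control value may still be [+oo]. Weak duality then makes the estimation value [+oo],
    and any trajectory obeying the dynamics attains it. *)

Section Dot.
Context {R : realType}.

Lemma dotE n (x u : 'cV[R]_n) : dot x u = \sum_i x i 0 * u i 0.
Proof. by rewrite /dot mxE; apply: eq_bigr => i _; rewrite mxE. Qed.

Lemma dotC n (x u : 'cV[R]_n) : dot x u = dot u x.
Proof. by rewrite !dotE; apply: eq_bigr => i _; rewrite mulrC. Qed.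

Lemma dotDr n (x u v : 'cV[R]_n) : dot x (u + v) = dot x u + dot x v.
Proof. by rewrite /dot mulmxDr mxE. Qed.

Lemma dotZr n (x : 'cV[R]_n) a u : dot x (a *: u) = a * dot x u.
Proof. by rewrite /dot -scalemxAr mxE. Qed.

Lemma dotDl n (x y u : 'cV[R]_n) : dot (x + y) u = dot x u + dot y u.
Proof. by rewrite dotC dotDr !(dotC u). Qed.

Lemma dotZl n (x u : 'cV[R]_n) a : dot (a *: x) u = a * dot x u.
Proof. by rewrite dotC dotZr dotC. Qed.

Lemma dotNr n (x u : 'cV[R]_n) : dot x (- u) = - dot x u.
Proof. by rewrite -scaleN1r dotZr mulN1r. Qed.

Lemma dotNl n (x u : 'cV[R]_n) : dot (- x) u = - dot x u.
Proof. by rewrite -scaleN1r dotZl mulN1r. Qed.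

Lemma dotBr n (x u v : 'cV[R]_n) : dot x (u - v) = dot x u - dot x v.
Proof. by rewrite dotDr dotNr. Qed.

Lemma dotBl n (x y u : 'cV[R]_n) : dot (x - y) u = dot x u - dot y u.
Proof. by rewrite dotDl dotNl. Qed.

Lemma dot0r n (x : 'cV[R]_n) : dot x 0 = 0.
Proof. by rewrite -(scale0r 0) dotZr mul0r. Qed.

Lemma dot0l n (x : 'cV[R]_n) : dot 0 x = 0.
Proof. by rewrite dotC dot0r. Qed.

Lemma dot_sumr n (I : finType) (x : 'cV[R]_n) (u : I -> 'cV[R]_n) :
  dot x (\sum_i u i) = \sum_i dot x (u i).
Proof. by apply: (big_morph _ (dotDr x) (dot0r x)). Qed.

Lemma dot_mulr m n (x : 'cV[R]_m) (A : 'M[R]_(m, n)) u :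
  dot x (A *m u) = dot (A^T *m x) u.
Proof. by rewrite /dot trmx_mul trmxK mulmxA. Qed.

Lemma dot_mull m n (x : 'cV[R]_n) (A : 'M[R]_(m, n)) u :
  dot (A *m x) u = dot x (A^T *m u).
Proof. by rewrite dot_mulr trmxK. Qed.

Lemma dot_ge0 n (x : 'cV[R]_n) : 0 <= dot x x.
Proof. by rewrite dotE sumr_ge0// => i _; rewrite -expr2 sqr_ge0. Qed.

Lemma dot_eq0 n (x : 'cV[R]_n) : dot x x = 0 -> x = 0.
Proof.
rewrite dotE => /eqP; rewrite psumr_eq0; last first.
  by move=> i _; rewrite -expr2 sqr_ge0.
move=> /allP x0; apply/matrixP => i j; rewrite ord1 mxE.
by have /= := x0 i (mem_index_enum i); rewrite mulf_eq0 orbb => /eqP.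
Qed.

Lemma dot_gt0 n (x : 'cV[R]_n) : x <> 0 -> 0 < dot x x.
Proof.
by move=> x0; rewrite lt_neqAle dot_ge0 eq_sym andbT; apply/eqP => /dot_eq0.
Qed.

Lemma dot_col_mx m n (x u : 'cV[R]_m) (y v : 'cV[R]_n) :
  dot (col_mx x y) (col_mx u v) = dot x u + dot y v.
Proof. by rewrite /dot tr_col_mx mul_row_col mxE. Qed.

Lemma dot_delta n (x : 'cV[R]_n) i : dot x (delta_mx i 0) = x i 0.
Proof.
rewrite dotE (bigD1 i)//= big1 ?addr0 ?mxE ?eqxx ?mulr1// => j ji.
by rewrite mxE (negbTE ji) mulr0.
Qed.

Lemma dot_sym n (M : 'M[R]_n) x u : psd M -> dot x (M *m u) = dot u (M *m x).
Proof. by move=> [MT _]; rewrite dot_mulr MT dotC. Qed.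

Lemma quadZ n (M : 'M[R]_n) a x : quad M (a *: x) = a ^+ 2 * quad M x.
Proof. by rewrite /quad -scalemxAr dotZr dotZl mulrA expr2. Qed.

Lemma quadD n (M : 'M[R]_n) x u : psd M ->
  quad M (x + u) = quad M x + 2 * dot x (M *m u) + quad M u.
Proof.
move=> psdM; rewrite /quad mulmxDr !dotDl !dotDr (dot_sym u x psdM); ring.
Qed.

(* [quad M (d - s (M d))] is nonnegative for every [s], which forces its slope
   [- 2 |M d|^2] at [s = 0] to vanish. *)
Lemma psd_quad_eq0 n (M : 'M[R]_n) d : psd M -> quad M d = 0 -> M *m d = 0.
Proof.
move=> psdM d0; have [_ M0] := psdM; apply: dot_eq0; set v := M *m d.
have b0 := M0 v; have a0 := dot_ge0 v.
have := M0 (d + (- (dot v v / (quad M v + 1))) *: v).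
rewrite quadD// d0 quadZ -scalemxAr dotZr (dot_sym d v psdM) -/v.
set a := dot v v in a0 *; set b := quad M v in b0 *.
have b1 : b + 1 != 0 by rewrite gt_eqF// ltr_wpDl.
have -> : 0 + 2 * (- (a / (b + 1)) * a) + (- (a / (b + 1))) ^+ 2 * b =
  - (a / (b + 1)) ^+ 2 * (b + 2) by field.
rewrite mulNr oppr_ge0 => h.
have : (a / (b + 1)) ^+ 2 * (b + 2) == 0.
  by rewrite eq_le h mulr_ge0 ?sqr_ge0// addr_ge0.
rewrite mulf_eq0 (gt_eqF (_ : 0 < b + 2)) ?ltr_wpDl// orbF sqrf_eq0 mulf_eq0.
by rewrite invr_eq0 (negbTE b1) orbF => /eqP.
Qed.

End Dot.

Section QuadraticProgram.
Context {R : realType}.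

(** The vector [v] is in the column space of [K] exactly when it is orthogonal to every column of
    [cokermx K^T]; a column that is not orthogonal is the certificate. *)
Lemma fredholm_alternative p r (K : 'M[R]_(p, r)) (v : 'cV_p) :
  (exists x, K *m x = v) \/ (exists2 y, K^T *m y = 0 & dot v y != 0).
Proof.
have [|] := boolP (v^T <= K^T)%MS.
  move=> /submxP[D vD]; left; exists D^T.
  by apply: trmx_inj; rewrite trmx_mul trmxK.
rewrite submxE => h; right.
have [j hj] : exists j, (v^T *m cokermx K^T) 0 j != 0.
  apply: contrapT => /forallNP n0; move/negP: h; apply; apply/eqP/matrixP => i j.
  by rewrite ord1 [RHS]mxE; apply/eqP; move: (n0 j) => /negP/negPn.
exists (col j (cokermx K^T)); first by rewrite colE mulmxA mulmx_coker mul0mx.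
by rewrite /dot colE mulmxA -colE mxE.
Qed.

Context {n : nat} (Q : 'M[R]_n) (c : 'cV[R]_n) (psdQ : psd Q).

Definition qobj (x : 'cV[R]_n) : R := dot c x - 2^-1 * quad Q x.

(** The second-order expansion of a quadratic is exact; [c - Q *m x] is the gradient at [x]. *)
Lemma qobj_line (x : 'cV[R]_n) s (d : 'cV[R]_n) : qobj (x + s *: d) =
  qobj x + s * dot (c - Q *m x) d - 2^-1 * (s ^+ 2 * quad Q d).
Proof.
rewrite /qobj quadD// quadZ -scalemxAr !dotDr !dotZr dotBl.
rewrite (dotC (Q *m x)) (dot_sym x d psdQ); by field.
Qed.

Lemma qobj_le_tangent x y : qobj y <= qobj x + dot (c - Q *m x) (y - x).
Proof.
have -> : qobj y = qobj (x + 1 *: (y - x)) by rewrite scale1r addrC subrK.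
rewrite qobj_line mul1r gerBl mulr_ge0 ?invr_ge0//.
by rewrite expr1n mul1r; case: psdQ.
Qed.

Lemma qobj_segment x d s : 0 <= s <= 1 ->
  qobj x <= qobj (x + d) -> qobj x <= qobj (x + s *: d).
Proof.
move=> /andP[s0 s1]; rewrite -{1}(scale1r d) !qobj_line.
have := psdQ.2 d; set a := quad Q d; set e := dot _ d.
rewrite !mul1r expr1n mul1r => a0 h.
suff : s * (2^-1 * (s * a)) <= s * e by rewrite expr2; lra.
apply: ler_wpM2l => //; suff : s * a <= a by lra.
exact: ler_piMl.
Qed.

(** The alternative is applied to the stationarity system [Q x + B^T v = c], [B x = b]. A solution
    is a maximum by concavity. A certificate [(d, v)] has [B d = 0] and [Q d = - B^T v], so
    [quad Q d = 0], hence [Q d = 0] and [B^T v = 0]; what remains of the nonzero pairing is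
    [dot c d], whose sign is fixed by replacing [d] with [- d]. *)
Lemma affine_max_or_ray m (B : 'M[R]_(m, n)) (b : 'cV_m) x0 : B *m x0 = b ->
  (exists2 e, B *m e = b & forall x, B *m x = b -> qobj x <= qobj e) \/
  (exists d, [/\ B *m d = 0, Q *m d = 0 & 0 < dot c d]).
Proof.
move=> Bx0.
have [[x]|[y]] := fredholm_alternative (block_mx Q B^T B 0) (col_mx c b).
  rewrite -[x]vsubmxK mul_block_col mul0mx addr0 => /eq_col_mx[Qe Be].
  left; exists (usubmx x) => // y By.
  apply: (le_trans (qobj_le_tangent (usubmx x) y)).
  by rewrite -Qe (addrC (Q *m _)) addrK dot_mull trmxK mulmxBr By Be subrr dot0r addr0.
rewrite -[y]vsubmxK tr_block_mx trmxK trmx0 mul_block_col mul0mx addr0.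
rewrite -col_mx0 => /eq_col_mx[]; set d := usubmx y; set v := dsubmx y.
rewrite psdQ.1 => Qd Bd; rewrite dot_col_mx => cd; right.
have {Qd}Qd : Q *m d = - (B^T *m v) by apply/eqP; rewrite -addr_eq0 Qd.
have Qd0 : Q *m d = 0.
  apply: (psd_quad_eq0 psdQ).
  by rewrite /quad Qd dotNr dot_mulr trmxK Bd dot0l oppr0.
have Bv : B^T *m v = 0 by apply/eqP; rewrite -oppr_eq0 -Qd Qd0.
move: cd; rewrite -Bx0 dot_mull Bv dot0r addr0 => cd.
have [cd0|cd0] := ltrP 0 (dot c d); first by exists d.
exists (- d); split; rewrite ?mulmxN ?Bd ?Qd0 ?oppr0// dotNr oppr_gt0.
by rewrite lt_neqAle cd.
Qed.

Lemma hull_max_or_ray m (A : 'M[R]_(m, n)) (b : 'cV_m) (J : {set 'I_m}) (x0 : 'cV_n) :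
  (forall i, i \in J -> (A *m x0) i 0 = b i 0) ->
  (exists2 e : 'cV_n, forall i, i \in J -> (A *m e) i 0 = b i 0 &
     forall x : 'cV_n, (forall i, i \in J -> (A *m x) i 0 = b i 0) ->
       qobj x <= qobj e) \/
  (exists d : 'cV_n, [/\ forall i, i \in J -> (A *m d) i 0 = 0,
     Q *m d = 0 & 0 < dot c d]).
Proof.
(* Multiplying by [D] turns the equations outside [J] into [0 = 0], which selects rows without
   changing the dimension. *)
pose D : 'M[R]_m := diag_mx (\row_i (i \in J)%:R).
have DE (u : 'cV_m) i : (D *m u) i 0 = (i \in J)%:R * u i 0.
  by rewrite mul_diag_mx !mxE.
have DP (b' : 'cV_m) (x : 'cV_n) :
    D *m A *m x = D *m b' <-> forall i, i \in J -> (A *m x) i 0 = b' i 0.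
  rewrite -mulmxA; split=> [h i iJ|h].
    by move/colP: h => /(_ i); rewrite !DE iJ !mul1r.
  apply/colP => i; rewrite !DE.
  by case: (boolP (i \in J)) => [/h ->//|_]; rewrite !mul0r.
move=> /DP /affine_max_or_ray[[e /DP Ae emax]|[d [Ad Qd cd]]].
  by left; exists e => // x /DP; exact: emax.
right; exists d; split => // i iJ.
by rewrite ((DP 0 d).1 _ i iJ) ?mxE// mulmx0.
Qed.

(** [J] lists constraints that must be active, and others may be active as well; [J] empty gives the
    whole polyhedron. Indexing faces this way lets the number of constraints outside [J] serve as
    induction measure. *)
Definition polyface m (A : 'M[R]_(m, n)) (b : 'cV_m) (J : {set 'I_m}) :
    set 'cV[R]_n :=
  [set x | (forall i, (A *m x) i 0 <= b i 0) /\
           (forall i, i \in J -> (A *m x) i 0 = b i 0)].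

(* Ratio test: the first constraint hit on the way from [x] to [x + d]. *)
Lemma polyface_exit m (A : 'M[R]_(m, n)) b J x d :
  polyface A b J x -> (forall i, i \in J -> (A *m d) i 0 = 0) ->
  ~ polyface A b J (x + d) ->
  exists s i, [/\ 0 <= s <= 1, i \notin J & polyface A b (i |: J) (x + s *: d)].
Proof.
move=> [Ax AxJ] Ad out.
have AE s i : (A *m (x + s *: d)) i 0 = (A *m x) i 0 + s * (A *m d) i 0.
  by rewrite mulmxDr -scalemxAr !mxE.
pose bad i := b i 0 < (A *m x) i 0 + (A *m d) i 0.
have [i0 bi0] : exists i, bad i.
  apply: contrapT => /forallNP nb; apply: out; rewrite -(scale1r d); split=> i.
    by rewrite AE mul1r leNgt; apply/negP/nb.
  by move=> iJ; rewrite AE Ad// mulr0 addr0 AxJ.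
have bad_gt0 i : bad i -> 0 < (A *m d) i 0.
  by rewrite /bad => bi; have := Ax i; lra.
pose r i := (b i 0 - (A *m x) i 0) / (A *m d) i 0.
have [i bi ri] := arg_minP r bi0.
have di := bad_gt0 _ bi; exists (r i), i.
have r0 : 0 <= r i by rewrite divr_ge0 ?subr_ge0// ltW.
have r1 : r i <= 1 by rewrite ler_pdivrMr// mul1r; move: bi; rewrite /bad; lra.
have iJ : i \notin J by apply/negP => /Ad di0; rewrite di0 ltxx in di.
rewrite r0 r1; split => //; split=> j.
  rewrite AE; have [bj|] := boolP (bad j).
    have := ri _ bj; rewrite {2}/r ler_pdivlMr ?bad_gt0//; lra.
  rewrite /bad -leNgt => bj; have [dj|dj] := lerP 0 ((A *m d) j 0).
    by apply: le_trans bj; rewrite lerD2l ler_piMl.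
  by apply: le_trans (Ax j); rewrite gerDl mulr_ge0_le0// ltW.
rewrite !inE AE => /orP[/eqP ->|jJ].
  by rewrite divfK ?gt_eqF// addrC subrK.
by rewrite Ad// mulr0 addr0 AxJ.
Qed.

Lemma max_of_finitely_many (X : Type) (f : X -> R) (I : finType)
    (S : I -> set X) :
  (forall i, S i !=set0 -> exists2 x, S i x & forall y, S i y -> f y <= f x) ->
  (exists i, S i !=set0) ->
  exists i x, S i x /\ forall j y, S j y -> f y <= f x.
Proof.
move=> Smax [i0 [x0 Si0]].
have /choice[g gP] i : exists x, S i !=set0 ->
    S i x /\ forall y, S i y -> f y <= f x.
  have [/Smax[x Sx xmax]|Si] := pselect (S i !=set0); first by exists x.
  by exists x0 => /Si.
have Pi0 : `[< S i0 !=set0 >] by apply/asboolP; exists x0.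
have [i /asboolP Si imax] := @arg_maxP _ _ _ i0 (fun i => `[< S i !=set0 >])
  (fun i => f (g i)) Pi0.
exists i, (g i); split; first by have [] := gP i Si.
move=> j y Sj; have Nj : S j !=set0 by exists y.
apply: le_trans (imax j _); last exact/asboolP.
by have [_] := gP j Nj; apply.
Qed.

(* Frank-Wolfe. If the maximum over the affine hull of the face is not attained
   inside the face, every point of the face can be moved, without decreasing the
   objective, to a face on which one more constraint is active. *)
Lemma polyface_max m (A : 'M[R]_(m, n)) b K J :
  (forall x, polyface A b finset.set0 x -> qobj x <= K) ->
  polyface A b J !=set0 ->
  exists2 x, polyface A b J x & forall y, polyface A b J y -> qobj y <= qobj x.
Proof.
move=> bounded; have [k] := ubnP #|~: J|%N.
elim: k J => // k IH J ltk [x0 Jx0].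
have sub i x : polyface A b (i |: J) x -> polyface A b J x.
  by case=> Ax AJ; split => // j jJ; apply: AJ; rewrite !inE jJ orbT.
suff : (exists2 e, polyface A b J e & forall y, polyface A b J y -> qobj y <= qobj e)
    \/ forall x, polyface A b J x ->
      exists i y, [/\ i \notin J, polyface A b (i |: J) y & qobj x <= qobj y].
  case=> [[e Fe emax]|push]; first by exists e.
  have [i [y [Si ymax]]] : exists (i : 'I_m) x,
      [set x | i \notin J /\ polyface A b (i |: J) x] x /\
      forall j y, [set x | j \notin J /\ polyface A b (j |: J) x] y ->
        qobj y <= qobj x.
    apply: max_of_finitely_many => [i [x [iJ Fx]]|]; last first.
      by have [i [y [iJ Fy _]]] := push _ Jx0; exists i, y.
    have [||e Fe emax] := IH (i |: J).
    - have -> : ~: (i |: J) = (~: J) :\ i by apply/setP => j; rewrite !inE negb_or.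
      by move: ltk; rewrite (cardsD1 i) inE iJ add1n ltnS.
    - by exists x.
    - by exists e => // z [_]; exact: emax.
  case: Si => iJ Fy; exists y; first exact: sub Fy.
  move=> x Jx; have [j [w [jJ Fw xw]]] := push _ Jx.
  exact: le_trans xw (ymax j w _).
have [[e Ae emax]|[d [Ad Qd cd]]] := hull_max_or_ray Jx0.2.
  have [Fe|Fe] := pselect (polyface A b J e).
    by left; exists e => // y [_ /emax].
  right=> x Jx; have [||s [i [s01 iJ Fi]]] := @polyface_exit _ A b J x (e - x) Jx.
  - by move=> i iJ; rewrite mulmxBr mxE [X in _ + X]mxE Ae ?Jx.2 ?subrr.
  - by rewrite addrC subrK.
  exists i, (x + s *: (e - x)); split => //.
  apply: qobj_segment => //; rewrite addrC subrK; exact: emax Jx.2.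
(* Since [Q *m d = 0], the objective is affine and strictly increasing along [d], so boundedness
   forces the ray out of the face. *)
right=> x Jx.
have line s : qobj (x + s *: d) = qobj x + s * dot c d.
  rewrite qobj_line /quad Qd dot0r !mulr0 subr0 dotBl dot_mull psdQ.1 Qd dot0r.
  by rewrite subr0.
(* At this length the objective exceeds the bound [K] by at least [dot c d]. *)
pose s := `|K - qobj x| / dot c d + 1.
have s0 : 0 <= s by rewrite addr_ge0// divr_ge0// ltW.
have [||r [i [/andP[r0 _] iJ Fi]]] := @polyface_exit _ A b J x (s *: d) Jx.
- by move=> i iJ; rewrite -scalemxAr mxE Ad ?mulr0.
- move=> [Fs _]; have : polyface A b finset.set0 (x + s *: d).
    by split => // i; rewrite inE.
  move=> /bounded; rewrite line mulrDl mul1r divfK ?gt_eqF//.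
  by have := ler_norm (K - qobj x); lra.
exists i, (x + r *: (s *: d)); split => //.
by rewrite scalerA line lerDl mulr_ge0 ?mulr_ge0// ltW.
Qed.

Lemma qobj_slope_le0 (x d : 'cV[R]_n) :
  (forall s, 0 < s <= 1 -> qobj (x + s *: d) <= qobj x) ->
  dot (c - Q *m x) d <= 0.
Proof.
move=> h; rewrite leNgt; apply/negP; set a := dot _ _ => a0.
have q0 : 0 <= quad Q d := psdQ.2 d.
have aq0 : 0 < a + quad Q d by rewrite ltr_wpDr.
(* With [s = a / (a + quad Q d)] one has [s * a = s ^+ 2 * (a + quad Q d)], so the gain along [d] is
   [s ^+ 2 * (a + quad Q d / 2)], positive even when [quad Q d] vanishes. *)
have /h : 0 < a / (a + quad Q d) <= 1.
  by rewrite divr_gt0//= ler_pdivrMr// mul1r lerDl.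
rewrite qobj_line -/a => le0.
have : 0 < (a / (a + quad Q d)) ^+ 2 * (a + 2^-1 * quad Q d).
  by rewrite mulr_gt0 ?exprn_gt0 ?divr_gt0// ltr_wpDr// mulr_ge0.
have -> : (a / (a + quad Q d)) ^+ 2 * (a + 2^-1 * quad Q d) =
    a / (a + quad Q d) * a - 2^-1 * ((a / (a + quad Q d)) ^+ 2 * quad Q d).
  by field; rewrite gt_eqF.
lra.
Qed.

End QuadraticProgram.

(** * Multipliers for polyhedral constraints *)

Section KarushKuhnTucker.
Context {R : realType}.

(** Minimizing the distance from [g] to [A^T *m l] over the admissible [l] is the quadratic program
    with [Q = A A^T] and [c = A g]. Its objective is half of [dot g g] minus half the squared
    distance, hence bounded, and a maximizer exists; the last two conclusions are its first-order
    conditions. *)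
Lemma cone_projection m n (A : 'M[R]_(m, n)) (I : {set 'I_m}) (g : 'cV_n) :
  exists l : 'cV_m, [/\ forall i, 0 <= l i 0, forall i, i \notin I -> l i 0 = 0,
    forall i, i \in I -> (A *m (g - A^T *m l)) i 0 <= 0 &
    dot (A^T *m l) (g - A^T *m l) = 0].
Proof.
pose Q := A *m A^T; pose c := A *m g.
have quadE l : quad Q l = dot (A^T *m l) (A^T *m l).
  by rewrite /quad /Q -mulmxA dot_mulr.
have psdQ : psd Q.
  by split=> [|l]; rewrite ?trmx_mul ?trmxK// quadE dot_ge0.
pose D : 'M[R]_m := diag_mx (\row_i (i \notin I)%:R).
have DE (u : 'cV_m) i : (D *m u) i 0 = (i \notin I)%:R * u i 0.
  by rewrite mul_diag_mx !mxE.
(* The rows of [- 1%:M] impose [l >= 0], those of [D] impose [l <= 0] outside [I]. *)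
pose P := polyface (col_mx (- 1%:M) D) 0 finset.set0.
have PP l : P l <-> (forall i, 0 <= l i 0) /\ (forall i, i \notin I -> l i 0 <= 0).
  rewrite /P /polyface/= mul_col_mx mulNmx mul1mx; split=> [[h _]|[h1 h2]].
    split=> i; first by have := h (lshift m i); rewrite col_mxEu !mxE oppr_le0.
    by move=> iI; have := h (rshift m i); rewrite col_mxEd DE iI mul1r mxE.
  split=> i; last by rewrite inE.
  case: (split_ordP i) => j ->; rewrite ?col_mxEu ?col_mxEd [leRHS]mxE.
    by rewrite mxE oppr_le0.
  by rewrite DE; case: (boolP (j \in I)) => [_|/h2]; rewrite ?mul0r ?mul1r.
have [l Pl lmax] : exists2 l, P l & forall y, P y -> qobj Q c y <= qobj Q c l.
  apply: (@polyface_max _ _ _ _ psdQ _ _ _ (2^-1 * dot g g)).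
    move=> l _; rewrite /qobj quadE {1}/c (dot_mull g).
    have := dot_ge0 (g - A^T *m l).
    rewrite dotBl !dotBr (dotC (A^T *m l) g); lra.
  by exists 0; apply/PP; split=> i; rewrite ?mxE.
have [l0 lI] := (PP l).1 Pl.
have cE : c - Q *m l = A *m (g - A^T *m l) by rewrite mulmxBr mulmxA.
have slope d : (forall s, 0 < s <= 1 -> P (l + s *: d)) ->
    dot (A *m (g - A^T *m l)) d <= 0.
  by move=> h; rewrite -cE; apply: (qobj_slope_le0 psdQ) => s /h/lmax.
exists l; split => //.
- by move=> i iI; apply/eqP; rewrite eq_le l0 lI.
- move=> i iI; rewrite -dot_delta; apply: slope => s /andP[s0 _].
  apply/PP; split=> j; rewrite !mxE eqxx andbT.
    by rewrite addr_ge0// mulr_ge0// ltW.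
  move=> jI; have ji : j == i = false by apply: contraNF jI => /eqP ->.
    by rewrite ji mulr0 addr0 lI.
(* The polyhedron [P] is a cone, so [l] may be both shrunk and stretched; the slope along [l] thus
   vanishes, which is the orthogonality claimed. *)
- have ge : dot (A *m (g - A^T *m l)) (- l) <= 0.
    apply: slope => s /andP[s0 s1]; apply/PP; split=> j; rewrite !mxE.
      by have := l0 j; rewrite mulrN subr_ge0 => lj; rewrite ler_piMl.
    by move=> jI; have := lI _ jI; have := l0 j; nra.
  have le : dot (A *m (g - A^T *m l)) l <= 0.
    apply: slope => s /andP[s0 s1]; apply/PP; split=> j; rewrite !mxE.
      by rewrite addr_ge0 ?mulr_ge0// ltW.
    by move=> jI; have := lI _ jI; have := l0 j; nra.
  move: ge le; rewrite dotNr dot_mull dotC; lra.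
Qed.

Lemma small_step (I : finType) (s t : I -> R) : (forall i, 0 < t i) ->
  exists2 e, 0 < e & forall i, e * s i <= t i.
Proof.
move=> t0; have [/pred0P I0|/pred0Pn[i0 _]] := boolP (pred0b (mem I)).
  by exists 1 => // i; have := I0 i.
have [j _ jmin] := @arg_minP _ _ _ i0 xpredT (fun i => t i / (1 + `|s i|)) isT.
have p i : 0 < 1 + `|s i| by rewrite ltr_pwDl.
exists (t j / (1 + `|s j|)) => [|i]; first by rewrite divr_gt0.
apply: (@le_trans _ _ (t j / (1 + `|s j|) * (1 + `|s i|))).
  apply: ler_wpM2l; first by rewrite ltW// divr_gt0.
  by have := ler_norm (s i); lra.
by rewrite -ler_pdivlMr// jmin.
Qed.

(* The gradient at the maximum is projected onto the cone generated by the active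
   constraints; the residual is a feasible ascent direction unless it vanishes. *)
Lemma qobj_kkt m n (A : 'M[R]_(m, n)) b Q c x : psd Q ->
  polyface A b finset.set0 x ->
  (forall y, polyface A b finset.set0 y -> qobj Q c y <= qobj Q c x) ->
  exists l : 'cV_m, [/\ forall i, 0 <= l i 0, A^T *m l = c - Q *m x &
    dot l (b - A *m x) = 0].
Proof.
move=> psdQ [Px _] xmax; pose g := c - Q *m x.
pose I := [set i | (A *m x) i 0 == b i 0]%SET.
have [l [l0 lI rI rl]] := cone_projection A I g.
exists l; set r := g - A^T *m l in rI rl; split => //; last first.
  rewrite dotE big1// => i _; have [|/lI ->] := boolP (i \in I).
    by rewrite inE => /eqP E; rewrite mxE [X in _ + X]mxE E subrr mulr0.
  by rewrite mul0r.
(* The step keeps the inactive constraints satisfied. For active ones the bound [1] is a mere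
   placeholder: there [rI] already says that moving along [r] does not increase the left-hand
   side. *)
have [e e0 es] : exists2 e, 0 < e & forall i, e * (A *m r) i 0 <=
    if i \in I then 1 else b i 0 - (A *m x) i 0.
  apply: small_step => i; case: ifPn => //; rewrite inE => ne.
  by rewrite subr_gt0 lt_neqAle ne Px.
have : dot (c - Q *m x) (e *: r) <= 0.
  apply: (qobj_slope_le0 psdQ) => s /andP[s0 s1]; apply: xmax; split=> i.
    rewrite mulmxDr -!scalemxAr mxE [X in _ + X]mxE [X in _ * X]mxE -lerBrDl.
    have [iI|iI] := boolP (i \in I).
      apply: (@le_trans _ _ 0); last by rewrite subr_ge0 Px.
      by rewrite (mulr_ge0_le0 (ltW s0))// mulr_ge0_le0 ?rI// ltW.
    have := es i; rewrite (negbTE iI) => le.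
    have [Ar|/ltW Ar] := lerP 0 (e * (A *m r) i 0).
      by apply: le_trans le; rewrite ler_piMl.
    by apply: (@le_trans _ _ 0); rewrite ?subr_ge0// mulr_ge0_le0// ltW.
  by rewrite inE.
rewrite -/g dotZr pmulr_rle0// => gr.
have : dot r r = 0.
  apply/eqP; rewrite eq_le dot_ge0 andbT.
  by move: gr; rewrite -{1}(subrK (A^T *m l) g) -/r dotDl rl addr0.
by move=> /dot_eq0/eqP; rewrite subr_eq0 => /eqP.
Qed.

(** A partial dualization: the inequalities remain conditions on [y], and their multipliers enter
    only through a nonpositive sum that is dropped. Each equality is split into two inequalities, so
    its multiplier has no sign. *)
Lemma qobj_strong_duality n (Q : 'M[R]_n) c (I J : finType)
    (a : I -> 'cV_n) (b : I -> R) (g : J -> 'cV_n) K : psd Q ->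
  let feasible x := (forall i, dot (a i) x <= b i) /\ (forall j, dot (g j) x = 0) in
  (exists x, feasible x) -> (forall x, feasible x -> qobj Q c x <= K) ->
  exists x (l : J -> R), feasible x /\
    forall y, (forall i, dot (a i) y <= b i) ->
      qobj Q c y + \sum_j l j * dot (g j) y <= qobj Q c x.
Proof.
move=> psdQ feasible [x0 Fx0] bounded.
pose L : finType := (I + (J + J))%type.
pose f (k : L) : 'cV[R]_n :=
  match k with inl i => a i | inr (inl j) => g j | inr (inr j) => - g j end.
pose h (k : L) := if k is inl i then b i else 0.
pose A : 'M[R]_(#|L|, n) := \matrix_(i, j) f (enum_val i) j 0.
pose B : 'cV[R]_#|L| := \col_i h (enum_val i).
have AE x k : (A *m x) k 0 = dot (f (enum_val k)) x.
  by rewrite dotE mxE; apply: eq_bigr => j _; rewrite mxE.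
have FP x : polyface A B finset.set0 x <-> feasible x.
  split=> [[h1 _]|[h1 h2]].
    have {}h1 (k : L) : dot (f k) x <= h k.
      by have := h1 (enum_rank k); rewrite AE mxE enum_rankK.
    split=> [i|j]; first exact: (h1 (inl i)).
    apply/eqP; rewrite eq_le (h1 (inr (inl j))) /=.
    by have := h1 (inr (inr j)); rewrite /= dotNl oppr_le0.
  split=> k; last by rewrite inE.
  rewrite AE mxE; case: (enum_val k) => [i|[j|j]] //=; first by rewrite h2.
  by rewrite dotNl h2 oppr0.
have [x Px xmax] : exists2 x, polyface A B finset.set0 x &
    forall y, polyface A B finset.set0 y -> qobj Q c y <= qobj Q c x.
  apply: (@polyface_max _ _ _ _ psdQ _ _ _ K) => [x /FP/bounded//|].
  by exists x0; apply/FP.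
have [l [l0 lA lB]] := qobj_kkt psdQ Px xmax.
pose t k := l (enum_rank k) 0.
have tA y : dot (c - Q *m x) y = \sum_k t k * dot (f k) y.
  rewrite -lA dot_mull trmxK dotE (reindex_onto enum_rank enum_val)/=; last first.
    by move=> k _; exact: enum_valK.
  apply: eq_big => [k|k _]; first by rewrite enum_rankK eqxx.
  by rewrite AE enum_rankK.
have tB : \sum_k t k * (h k - dot (f k) x) = 0.
  rewrite -[RHS]lB dotE [RHS](reindex_onto enum_rank enum_val)/=; last first.
    by move=> k _; exact: enum_valK.
  apply: eq_big => [k|k _]; first by rewrite enum_rankK eqxx.
  by rewrite [in RHS]mxE [in RHS]mxE [in RHS]mxE AE enum_rankK.
(* With this sign the price cancels the component of the gradient along [g j]. *)
exists x, (fun j => t (inr (inr j)) - t (inr (inl j))).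
split=> [|y ay]; first exact/FP.
apply: (le_trans (lerD (qobj_le_tangent c psdQ x y) (lexx _))).
rewrite -addrA gerDl dotBr [in leLHS]tA.
have -> : dot (c - Q *m x) x = \sum_k t k * h k.
  rewrite tA; apply/esym/eqP; rewrite -subr_eq0 -sumrB -[X in _ == X]tB.
  by apply/eqP/eq_bigr => k _; rewrite mulrBr.
have -> : \sum_k t k * h k = \sum_i t (inl i) * b i.
  rewrite !big_sumType/= -[RHS]addr0; congr (_ + _).
  by rewrite -big_split big1// => j _; rewrite /= !mulr0 addr0.
rewrite addrAC; apply: (@le_trans _ _ (\sum_i t (inl i) * (dot (a i) y - b i))).
  rewrite !big_sumType/= -!addrA [X in _ + X](_ : _ = - \sum_i t (inl i) * b i).
    by rewrite -sumrB ler_sum// => i _; rewrite mulrBr.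
  rewrite !addrA -[RHS]add0r; congr (_ - _); rewrite -!big_split big1//= => j _.
  by rewrite dotNl; ring.
by apply: sumr_le0 => i _; rewrite mulr_ge0_le0 ?l0// subr_le0.
Qed.

End KarushKuhnTucker.

(** * Translation of the densities *)

Section TranslationInvariance.
Context {R : realType}.
Local Notation mR := (measurableTypeR R).
Import HBNNSimple.

(** If [h] is a simple function below [f], then [k * (h \o phi)] is again one, and its integral is
    [k] times that of [h] by invariance of [mu]. Working with simple functions below [f] spares a
    measurability proof for the density. *)
Lemma ge0_integral_contraction d (X : measurableType d)
    (mu : {measure set X -> \bar R}) (phi : X -> X) (f : X -> \bar R) k :
  measurable_fun [set: X] phi ->
  (forall A, measurable A -> mu (phi @^-1` A) = mu A) ->
  (forall x, 0 <= f x)%E -> 0 <= k -> (forall x, k%:E * f (phi x) <= f x)%E ->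
  (k%:E * \int[mu]_x f x <= \int[mu]_x f x)%E.
Proof.
move=> mphi muphi f0 k0 kf.
have [->|kn0] := eqVneq k 0; first by rewrite mul0e integral_ge0.
rewrite !ge0_integralTE//.
have kpos : 0 < k by rewrite lt_neqAle eq_sym kn0.
rewrite -lee_pdivlMl//; apply: ge_ereal_sup => _ [h /= hf <-].
rewrite lee_pdivlMl//.
have mg : measurable_fun [set: X] (h \o phi) by exact: measurableT_comp.
have fg : finite_set (range (h \o phi)).
  by apply: sub_finite_set (fimfunP h) => _ [x _ <-]; exists (phi x).
have g0 x : 0 <= (h \o phi) x by exact: fun_ge0.
pose g : {nnsfun X >-> R} := HB.pack (h \o phi)
  (isMeasurableFun.Build _ _ _ _ (h \o phi) mg)
  (FiniteImage.Build _ _ (h \o phi) fg) (isNonNegFun.Build _ _ (h \o phi) g0).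
have -> : sintegral mu h = sintegral mu g.
  rewrite !sintegralET; apply: eq_fsbigr => r _; congr (_ * _)%E.
  by rewrite -[LHS]muphi.
rewrite -sintegralrM; apply: ereal_sup_ubound => /=.
exists (scale_nnsfun g k0) => //= x.
rewrite EFinM; apply: le_trans (kf x).
by rewrite lee_pmul2l// hf.
Qed.

(** The image measure agrees with Lebesgue measure on half-open intervals, which determine it. *)
Lemma lebesgue_measure_translation (a : R) (A : set mR) : measurable A ->
  lebesgue_measure ((fun x : mR => x + a : mR) @^-1` A) = lebesgue_measure A.
Proof.
move=> mA; have ma : measurable_fun [set: mR] (fun x : mR => x + a : mR).
  by apply: measurable_funD => //; exact: measurable_id.
rewrite -[LHS]/(pushforward lebesgue_measure (fun x : mR => x + a : mR) A).
apply/esym/lebesgue_measure_unique => //= _ [[x y]] _ <-.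
rewrite /pushforward [X in _ = _ X](_ : _ = `]x - a, y - a]%classic).
  rewrite !lebesgue_measure_itv/= !lte_fin ltrD2r -!EFinB.
  by rewrite (_ : y - a - (x - a) = y - x)//; ring.
by apply/seteqP; split=> r /=; rewrite !in_itv/= ltrBlDr lerBrDr.
Qed.

Definition tuple_shift n (a v : n.-tuple mR) : n.-tuple mR :=
  [tuple tnth v i + tnth a i | i < n].

Lemma measurable_tuple_shift n (a : n.-tuple mR) :
  measurable_fun [set: n.-tuple mR] (tuple_shift a).
Proof.
apply/measurable_fun_tnthP => i.
rewrite (_ : _ \o _ = fun v : n.-tuple mR => tnth v i + tnth a i).
  by apply: measurable_funD => //; exact: measurable_tnth.
by apply/funext => v /=; rewrite tnth_mktuple.
Qed.

(** Under [tuple_cons] the shift acts separately on head and tail, so uniqueness of the product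
    measure reduces the claim to rectangles. *)
Lemma lebesgue_tuple_translation n (a : n.-tuple mR) A : measurable A ->
  lebesgue_tuple n (tuple_shift a @^-1` A) = lebesgue_tuple n A.
Proof.
elim: n a A => [|n IH] a A mA.
  congr (_ _); apply/seteqP; split=> v /=; by rewrite (tuple0 (tuple_shift _ _)) (tuple0 v).
rewrite /= /cons_measure /pushforward.
pose a0 := thead a; pose a' := [tuple of behead a].
pose sigma (p : mR * n.-tuple mR) : mR * n.-tuple mR :=
  (p.1 + a0, tuple_shift a' p.2).
have msigma : measurable_fun setT sigma.
  apply/measurable_fun_pairP; split.
    by apply: measurable_funD => //; exact: measurable_fst.
  exact: measurableT_comp (measurable_tuple_shift a') measurable_snd.
have shiftE p : tuple_shift a (tuple_cons p) = tuple_cons (sigma p).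
  apply: eq_from_tnth => i; rewrite tnth_mktuple.
  case: (unliftP ord0 i) => [j|] ->.
    rewrite /tuple_cons !tnthS tnth_mktuple; congr (_ + _).
    by rewrite (tuple_eta a) tnthS.
  by rewrite /tuple_cons !tnth0.
rewrite -[in LHS]comp_preimage (_ : _ \o _ = @tuple_cons R n \o sigma); last first.
  by apply/funext => p /=; rewrite shiftE.
rewrite comp_preimage; set B := _ @^-1` A.
have mB : measurable B.
  by rewrite -[X in measurable X]setTI; apply: measurable_tuple_cons.
rewrite -[LHS]/(pushforward (lebesgue_measure \x lebesgue_tuple n)%E sigma B).
apply/esym/product_measure_unique => // C D mC mD.
rewrite -[LHS]/((lebesgue_measure \x lebesgue_tuple n)%E
    (((fun x : mR => x + a0 : mR) @^-1` C) `*` (tuple_shift a' @^-1` D))).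
have mC' : measurable ((fun x : mR => x + a0 : mR) @^-1` C).
  by rewrite -[X in measurable X]setTI; apply: measurable_funD.
have mD' : measurable (tuple_shift a' @^-1` D).
  by rewrite -[X in measurable X]setTI; apply: measurable_tuple_shift.
rewrite product_measure1E//; congr (_ * _)%E; last exact: IH.
exact: lebesgue_measure_translation.
Qed.

End TranslationInvariance.

(** * Monitoring functions and the origin *)

Section Monitoring.
Context {R : realType} {n : nat}.
Implicit Types (U : set 'cV[R]_n) (M : 'M[R]_n).

(** The violated row of the system is itself the separating functional. *)
Lemma polyhedral_out U u : polyhedral U -> ~ U u ->
  exists a b, b < dot a u /\ forall v, U v -> dot a v <= b.
Proof.
move=> [m [A [b ->]]] /= /existsNP[i /negP]; rewrite -ltNge => Au.
have rowE v : dot (row i A)^T v = (A *m v) i 0.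
  by rewrite /dot trmxK -row_mul mxE.
exists (row i A)^T, (b i 0); rewrite rowE; split => // v /(_ i).
by rewrite rowE.
Qed.

Lemma monitoring_ge U M x u : U u ->
  ((dot x u - 2^-1 * quad M u)%:E <= monitoring U M x)%E.
Proof. by move=> Uu; apply: ereal_sup_ubound; exists u. Qed.

Lemma monitoring_le U M x K :
  (forall u, U u -> ((dot x u - 2^-1 * quad M u)%:E <= K)%E) ->
  (monitoring U M x <= K)%E.
Proof. by move=> h; apply: ge_ereal_sup => _ [u Uu <-]; exact: h. Qed.

Lemma monitoring_gtNy U M x : U !=set0 -> (-oo < monitoring U M x)%E.
Proof.
by move=> [u Uu]; apply: lt_le_trans (monitoring_ge M x Uu); rewrite ltNyr.
Qed.

Lemma monitoring_shift U M x a b : (forall u, U u -> dot a u <= b) ->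
  (monitoring U M (x + a) <= monitoring U M x + b%:E)%E.
Proof.
move=> aUb; apply: monitoring_le => u Uu.
have := leeD (monitoring_ge M x Uu) (lexx b%:E); apply: le_trans.
rewrite -EFinD lee_fin dotDl; have := aUb _ Uu; lra.
Qed.

(* If [0] is outside [U], some [a] satisfies [dot a u <= b < 0] on [U]; then
   translating by [a] multiplies the density by at least [expR (- b) > 1], while
   its Lebesgue integral is translation invariant. *)
Lemma density_monitoring0 U M d (Omega : measurableType d)
    (P : probability Omega R) (X : {RV P >-> n.-tuple (measurableTypeR R)}) :
  polyhedral U ->
  density_proportional_to X (fun x => expeR (- monitoring U M x)%E) -> U 0.
Proof.
move=> polyU [c c0 dens]; apply: contrapT => /(polyhedral_out polyU)[a [b []]].
rewrite dot0r => b0 aUb.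
(* The shift is by [- a]: [monitoring_shift] then bounds the monitoring function at [v] by its value
   at [v - a] plus [b]. *)
pose t : n.-tuple (measurableTypeR R) := [tuple - a i 0 | i < n].
pose f (v : n.-tuple (measurableTypeR R)) :=
  (c%:E * expeR (- monitoring U M (vec_of_tuple v)))%E.
have f1 : (\int[lebesgue_tuple n]_v f v = 1)%E.
  by rewrite -dens// probability_setT.
have := @ge0_integral_contraction R _ _ (lebesgue_tuple n) (tuple_shift t) f
  (expR (- b)) (measurable_tuple_shift t) (lebesgue_tuple_translation t).
rewrite f1 mule1 => h.
suff : (expR (- b) <= 1)%R by rewrite leNgt expR_gt1 oppr_gt0 b0.
rewrite -lee_fin; apply: h.
- by move=> v; rewrite mule_ge0 ?expeR_ge0// lee_fin ltW.
- exact: expR_ge0.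
move=> v; rewrite /f muleCA; apply: lee_wpmul2l; first by rewrite lee_fin ltW.
have -> : (expR (- b))%:E = expeR (- b)%:E by [].
have vE : vec_of_tuple v = vec_of_tuple (tuple_shift t v) + a.
  by apply/colP => i; rewrite !mxE !tnth_mktuple subrK.
have := monitoring_shift M (vec_of_tuple (tuple_shift t v)) aUb; rewrite -vE.
case: (monitoring U M (vec_of_tuple (tuple_shift t v))) => [r||].
- case: (monitoring U M (vec_of_tuple v)) => [s||]//= h'.
  + by rewrite -EFinM lee_fin -expRD ler_expR; move: h'; rewrite lee_fin; lra.
  + by rewrite leey.
- by move=> _ /=; rewrite mule0 expeR_ge0.
- by rewrite leeNy_eq => /eqP ->; rewrite /= leey.
Qed.

End Monitoring.

(** * Conjugates of monitoring functions *)

Section MonitoringDuality.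
Context {R : realType} {n : nat}.
Implicit Types (U : set 'cV[R]_n) (M : 'M[R]_n).

Lemma quad_convex M x u l : psd M -> 0 <= l <= 1 ->
  quad M (l *: x + (1 - l) *: u) <= l * quad M x + (1 - l) * quad M u.
Proof.
move=> psdM /andP[l0 l1].
have := psdM.2 (x - u).
rewrite !quadD// !quadZ -scaleN1r quadZ -!scalemxAr !dotZr dotZl => h.
have : 0 <= l * (1 - l) * (quad M x + 2 * (-1 * dot x (M *m u)) + (-1) ^+ 2 * quad M u).
  by rewrite mulr_ge0// mulr_ge0// subr_ge0.
nra.
Qed.

Lemma polyhedral_convex U u v l : polyhedral U -> 0 <= l <= 1 ->
  U u -> U v -> U (l *: u + (1 - l) *: v).
Proof.
move=> polyU /andP[l0 l1] Uu Uv; apply: contrapT => /(polyhedral_out polyU).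
move=> [a [b [ab aU]]]; move: ab; rewrite dotDr !dotZr.
have := aU _ Uu; have := aU _ Uv; nra.
Qed.

Lemma monitoring_convex U M x y a b l : 0 <= l <= 1 ->
  (monitoring U M x <= a%:E)%E -> (monitoring U M y <= b%:E)%E ->
  (monitoring U M (l *: x + (1 - l) *: y) <= (l * a + (1 - l) * b)%:E)%E.
Proof.
move=> /andP[l0 l1] xa yb; apply: monitoring_le => u Uu.
have := le_trans (monitoring_ge M x Uu) xa.
have := le_trans (monitoring_ge M y Uu) yb.
rewrite !lee_fin dotDl !dotZl; nra.
Qed.

(** Completing the square: at [M *m u] the values at [u] and [v] differ by half of [quad M (u - v)].
    These points serve below as explicit places where the monitoring function is finite. *)
Lemma monitoring_mul U M u : psd M -> U u ->
  monitoring U M (M *m u) = (2^-1 * quad M u)%:E.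
Proof.
move=> psdM Uu; apply/eqP; rewrite eq_le; apply/andP; split.
  apply: monitoring_le => v Uv; rewrite lee_fin.
  have := psdM.2 (u - v).
  rewrite quadD// -scaleN1r quadZ -scalemxAr dotZr dot_mull psdM.1; nra.
apply: le_trans (monitoring_ge M _ Uu); rewrite lee_fin dotC /quad; lra.
Qed.

(** The upper bound is the Fenchel-Young inequality, with equality at [v = M *m u]. *)
Lemma conjugate_monitoring_in U M u : psd M -> U u ->
  conjugate (monitoring U M) u = (2^-1 * quad M u)%:E.
Proof.
move=> psdM Uu; apply/eqP; rewrite eq_le; apply/andP; split.
  apply: ge_ereal_sup => _ [v _ <-]; have := monitoring_ge M v Uu.
  case: (monitoring U M v) => [r||]; rewrite ?leeNy_eq//= ?leNye// !lee_fin; lra.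
apply: ereal_sup_ubound; exists (M *m u) => //.
by rewrite monitoring_mul// -EFinB dotC -/(quad M u); congr EFin; lra.
Qed.

Lemma monitoring_conjugate_unbounded U M u K : psd M -> polyhedral U ->
  U !=set0 -> ~ U u ->
  exists v m, monitoring U M v = m%:E /\ K <= dot v u - m.
Proof.
move=> psdM polyU [u0 Uu0] /(polyhedral_out polyU)[a [b [ab aU]]].
pose C := dot (M *m u0) u - 2^-1 * quad M u0.
(* Along the separating direction [a] the pairing with [u] grows at rate [dot a u], the monitoring
   function at rate at most [b]; this [s] makes the net gain over the starting value [C] equal to
   the absolute value of [K - C]. *)
pose s := `|K - C| / (dot a u - b).
have s0 : 0 <= s by rewrite divr_ge0// subr_ge0 ltW.
have saU w : U w -> dot (s *: a) w <= s * b.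
  by move=> /aU; rewrite dotZl; exact: ler_wpM2l.
have := monitoring_shift M (M *m u0) saU; rewrite monitoring_mul// -EFinD.
have := monitoring_ge M (M *m u0 + s *: a) Uu0.
case E : (monitoring U M (M *m u0 + s *: a)) => [m||]; last 2 first.
- by rewrite leye_eq.
- by rewrite leeNy_eq.
move=> _; rewrite lee_fin => le_m; exists (M *m u0 + s *: a), m; split => //.
rewrite dotDl dotZl.
have : s * (dot a u - b) = `|K - C| by rewrite divfK// gt_eqF// subr_gt0.
have := ler_norm (K - C); rewrite /C; lra.
Qed.

Lemma conjugate_monitoring_out U M u : psd M -> polyhedral U -> U !=set0 ->
  ~ U u -> conjugate (monitoring U M) u = +oo%E.
Proof.
move=> psdM polyU U0 Uu; apply: eq_infty => K.
have [v [m [vm Km]]] := monitoring_conjugate_unbounded K psdM polyU U0 Uu.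
apply: le_trans (_ : ((dot v u)%:E - monitoring U M v <= _)%E).
  by rewrite vm -EFinB lee_fin.
by apply: ereal_sup_ubound; exists v.
Qed.

(* The coordinates are maximized one at a time. *)
Lemma sum_monitoring_le (I : finType) (U : I -> set 'cV[R]_n) (M : I -> 'M[R]_n)
    (x : I -> 'cV[R]_n) K : (forall i, U i !=set0) ->
  (forall u, (forall i, U i (u i)) ->
     \sum_i (dot (x i) (u i) - 2^-1 * quad (M i) (u i)) <= K) ->
  (\sum_i monitoring (U i) (M i) (x i) <= K%:E)%E.
Proof.
move=> U0; pose f i u := dot (x i) u - 2^-1 * quad (M i) u => h.
have {h} : forall u, (forall i, U i (u i)) ->
    \sum_(i <- index_enum I) f i (u i) <= K by [].
elim: (index_enum I) (index_enum_uniq I) K => [|i s IH] /=.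
  move=> _ K h; have /choice[u0 Uu0] := U0.
  by have := h u0 Uu0; rewrite !big_nil lee_fin.
move=> /andP[inots us] K h.
have hs v : U i v -> (\sum_(j <- s) monitoring (U j) (M j) (x j) <= (K - f i v)%:E)%E.
  move=> Uv; apply: IH => // u Uu.
  pose u' j := if j == i then v else u j.
  have Uu' j : U j (u' j) by rewrite /u'; case: eqP => [->|].
  have := h u' Uu'; rewrite big_cons {1}/u' eqxx lerBrDl.
  rewrite (eq_big_seq (fun j => f j (u j)))// => j js.
  by rewrite /u'; case: eqP => // ji; rewrite -ji js in inots.
rewrite big_cons; have [v0 Uv0] := U0 i; move: (hs v0 Uv0).
have sNy : \sum_(j <- s) monitoring (U j) (M j) (x j) <> -oo%E :> \bar R.
  move=> /esum_eqNyP [j [_ _ jNy]].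
  by have := @monitoring_gtNy _ _ (U j) (M j) (x j) (U0 j); rewrite jNy.
move: sNy hs; case: (\sum_(j <- s) _)%E => [r||]// _ hs _.
have : (monitoring (U i) (M i) (x i) <= (K - r)%:E)%E.
  by apply: monitoring_le => v /hs; rewrite !lee_fin /f; lra.
by rewrite EFinB leeBrDr.
Qed.

End MonitoringDuality.

Lemma econvexP (R : realType) (E : lmodType R) (C : set E) (f : E -> \bar R) :
  (forall p q a b l, 0 <= l <= 1 -> C p -> C q -> (f p <= a%:E)%E ->
     (f q <= b%:E)%E -> C (l *: p + (1 - l) *: q) /\
     (f (l *: p + (1 - l) *: q)%R <= (l * a + (1 - l) * b)%:E)%E) ->
  econvex C f.
Proof.
move=> h [p a] [q b] l; rewrite !inE /= => -[Cp fp] [Cq fq].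
by apply: h => //; apply/andP; split; [exact: ge0|exact: le1].
Qed.

(** * The estimation and control problems *)

Section LagrangianDuality.
Context {R : realType} {T nx nz : nat}.
Context (M : 'I_T.+1 -> 'M[R]_nx) (N : 'I_T.+1 -> 'M[R]_nz).
Context (W : 'I_T.+1 -> set 'cV[R]_nx) (V : 'I_T.+1 -> set 'cV[R]_nz).
Context (F : 'I_T -> 'M[R]_nx) (H : 'I_T.+1 -> 'M[R]_(nz, nx)).
Context (z : 'I_T.+1 -> 'cV[R]_nz).
Hypotheses (psdM : forall t, psd (M t)) (psdN : forall t, psd (N t)).
Hypotheses (polyW : forall t, polyhedral (W t)).
Hypotheses (polyV : forall t, polyhedral (V t)).
Hypotheses (W_neq0 : forall t, W t !=set0) (V_neq0 : forall t, V t !=set0).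
Implicit Types (w x y : @trajectory R T nx) (u : @trajectory R T nz).

Local Notation L := (lagrangian M N W V F H z).

(** [unlift ord0] is the predecessor index and is [None] at time 0, so the initial condition and the
    dynamics form one family of equations; [control_residual] treats the terminal time likewise
    through [ord_max]. *)
Definition map_residual w x (t : 'I_T.+1) : 'cV[R]_nx :=
  x t - w t - (if unlift ord0 t is Some j then F j *m x (time_cur j) else 0).

Definition control_residual u y (t : 'I_T.+1) : 'cV[R]_nx :=
  y t - (H t)^T *m u t -
  (if unlift ord_max t is Some j then (F j)^T *m y (time_succ j) else 0).

Lemma time_curE (t : 'I_T) : time_cur t = lift ord_max t.
Proof. by apply: val_inj; rewrite /= /bump leqNgt ltn_ord. Qed.

Lemma map_residualP w x :
  map_constraints F (w, x) <-> forall t, map_residual w x t = 0.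
Proof.
split=> [[xS x0] t|res0].
  rewrite /map_residual; case: unliftP => [j ->|->].
    by rewrite xS addrK subrr.
  by rewrite x0 subrr subr0.
split=> [t|].
  have := res0 (time_succ t); rewrite /map_residual /time_succ liftK => /eqP.
  by rewrite subr_eq0 subr_eq => /eqP.
have := res0 ord0; rewrite /map_residual unlift_none subr0 => /eqP.
by rewrite subr_eq0 => /eqP.
Qed.

Lemma control_residualP u y : control_constraints W V F H (u, y) <->
  (forall t, control_residual u y t = 0) /\ (forall t, W t (y t) /\ V t (u t)).
Proof.
split=> [[yS yT WV]|[res0 WV]]; split=> //.
- move=> t; rewrite /control_residual; case: unliftP => [j ->|->].
    by rewrite -time_curE yS addrK subrr.
  by rewrite yT subrr subr0.
- move=> t; have := res0 (time_cur t).
  rewrite /control_residual {4}time_curE liftK => /eqP.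
  by rewrite subr_eq0 subr_eq => /eqP.
- have := res0 ord_max; rewrite /control_residual unlift_none subr0 => /eqP.
  by rewrite subr_eq0 => /eqP.
Qed.

(* Summation by parts in time. *)
Lemma residual_duality w x u y :
  \sum_t dot (y t) (map_residual w x t) - \sum_t dot (u t) (H t *m x t) =
  \sum_t dot (x t) (control_residual u y t) - \sum_t dot (y t) (w t).
Proof.
have FE : \sum_t dot (y t)
      (if unlift ord0 t is Some j then F j *m x (time_cur j) else 0) =
    \sum_t dot (x t)
      (if unlift ord_max t is Some j then (F j)^T *m y (time_succ j) else 0).
  rewrite big_ord_recl big_ord_recr !unlift_none/= !dot0r add0r addr0.
  apply: eq_bigr => j _; rewrite -[widen_ord _ _]/(time_cur j) {2}time_curE.
  by rewrite !liftK dotC dot_mull.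
rewrite (eq_bigr (fun t => dot (y t) (x t) - dot (y t) (w t) -
  dot (y t) (if unlift ord0 t is Some j then F j *m x (time_cur j) else 0)));
  last by move=> t _; rewrite !dotBr.
rewrite [in RHS](eq_bigr (fun t => dot (y t) (x t) - dot (u t) (H t *m x t) -
  dot (x t) (if unlift ord_max t is Some j then (F j)^T *m y (time_succ j) else 0)));
  last by move=> t _; rewrite !dotBr (dotC (y t)) dot_mulr trmxK (dotC (H t *m x t)).
by rewrite !sumrB FE; ring.
Qed.

Definition lagrangian_real (phi : 'I_T.+1 -> R) w x u y : R :=
  \sum_t phi t + \sum_t (dot (z t) (u t) - 2^-1 * quad (N t) (u t)) +
  (\sum_t dot (y t) (map_residual w x t) - \sum_t dot (u t) (H t *m x t)).

Lemma lagrangian_fin phi w x u y :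
  (forall t, monitoring (W t) (M t) (w t) = (phi t)%:E) ->
  (forall t, V t (u t)) ->
  L (w, x) (u, y) = (lagrangian_real phi w x u y)%:E.
Proof.
move=> wphi Vu; rewrite /lagrangian.
rewrite (eq_bigr (fun t => (phi t + dot (z t) (u t) - 2^-1 * quad (N t) (u t) -
  dot (u t) (H t *m x t))%:E)); last first.
  by move=> t _; rewrite wphi conjugate_monitoring_in.
rewrite !DualAddTheoryNumDomain.dsumEFin -!DualAddTheoryNumDomain.dEFinD.
congr EFin; rewrite /lagrangian_real.
rewrite [X in _ + (X - _)]big_ord_recl {1}/map_residual unlift_none subr0.
rewrite (eq_bigr (fun t => phi t + (dot (z t) (u t) - 2^-1 * quad (N t) (u t)) -
  dot (u t) (H t *m x t))); last by move=> t _; rewrite addrA.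
rewrite sumrB big_split/= -!addrA; congr (_ + (_ + _)).
rewrite addrC -!addrA; congr (_ + (_ + _)).
apply: eq_bigr => t _; congr dot.
by rewrite /map_residual -/(time_succ t) /time_succ liftK addrAC.
Qed.

Lemma lagrangian_pinfty w x q :
  (exists t, monitoring (W t) (M t) (w t) = +oo%E) -> L (w, x) q = +oo%E.
Proof.
case: q => u y [t wt]; rewrite /lagrangian.
rewrite (DualAddTheoryNumDomain.desum_eqyP _ _ _).2 //.
by exists t; rewrite mem_index_enum wt.
Qed.

(** Finiteness at every [w t] matters: a single [+oo] would absorb the [-oo] produced by [u]. *)
Lemma lagrangian_ninfty phi w x u y :
  (forall t, monitoring (W t) (M t) (w t) = (phi t)%:E) ->
  (exists t, ~ V t (u t)) -> L (w, x) (u, y) = -oo%E.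
Proof.
move=> wphi [t Vut]; rewrite /lagrangian.
set S := (\sum_(t < T.+1) _)%dE; have -> : S = -oo%E.
  apply/DualAddTheoryNumDomain.desum_eqNyP => [i _|].
    rewrite wphi; have [Vui|Vui] := pselect (V i (u i)).
      by rewrite conjugate_monitoring_in.
    by rewrite conjugate_monitoring_out.
  by exists t; rewrite mem_index_enum wphi conjugate_monitoring_out.
by rewrite DualAddTheoryNumDomain.dsumEFin.
Qed.

Lemma monitoring_dichotomy w :
  (exists t, monitoring (W t) (M t) (w t) = +oo%E) \/
  exists phi, forall t, monitoring (W t) (M t) (w t) = (phi t)%:E.
Proof.
have [[t wt]|/forallNP wfin] := pselect (exists t, monitoring (W t) (M t) (w t) = +oo%E).
  by left; exists t.
right; exists (fun t => fine (monitoring (W t) (M t) (w t))) => t.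
have := wfin t; have := monitoring_gtNy (M t) (w t) (W_neq0 t).
by case: (monitoring _ _ _).
Qed.

Lemma forall_or_exists_not (I : Type) (X : I -> Type) (A : forall i, set (X i))
    (f : forall i, X i) :
  (forall i, A i (f i)) \/ exists i, ~ A i (f i).
Proof.
have [|/existsNP] := pselect (forall i, A i (f i)); first by left.
by right.
Qed.

Lemma lagrangian_lty w x q a : (L (w, x) q <= a%:E)%E ->
  exists phi, forall t, monitoring (W t) (M t) (w t) = (phi t)%:E.
Proof.
by have [/lagrangian_pinfty ->|//] := monitoring_dichotomy w; rewrite leye_eq.
Qed.

Lemma map_residual_conv w x w' x' l t :
  map_residual (l *: w + (1 - l) *: w') (l *: x + (1 - l) *: x') t =
  l *: map_residual w x t + (1 - l) *: map_residual w' x' t.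
Proof.
rewrite /map_residual; case: (unlift _ _) => [j|].
  rewrite -![(_ + _) _]/(_ _ + _ _) -![(_ *: _) _]/(_ *: _ _).
  rewrite mulmxDr -!scalemxAr !scalerBr !opprD !addrA.
  by rewrite -!scalerN; apply/matrixP => i k; rewrite !mxE; ring.
by apply/matrixP => i k; rewrite !mxE; ring.
Qed.

(** For fixed [(u, y)], [L] is finite-or-[-oo] only on the convex set where the monitoring values of
    [w] are finite; there it is real and convex, or constantly [-oo] if [u] leaves [V]. For fixed
    [(w, x)] it is constantly [+oo], or real and concave where [u] lies in [V] and [-oo]
    elsewhere. *)
Lemma lagrangian_convex_concave : convex_concave setT setT L.
Proof.
split=> [[u y] _|[w x] _]; apply: econvexP.
  move=> [w1 x1] [w2 x2] a b l.
  move=> l01 _ _ La Lb; split => //.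
  have [phi1 w1phi] := lagrangian_lty La; have [phi2 w2phi] := lagrangian_lty Lb.
  have wl t : (monitoring (W t) (M t) ((l *: w1 + (1 - l) *: w2)%R t) <=
      (l * phi1 t + (1 - l) * phi2 t)%:E)%E.
    by apply: monitoring_convex; rewrite ?w1phi ?w2phi.
  have [[t wt]|[phi wphi]] := monitoring_dichotomy (l *: w1 + (1 - l) *: w2).
    by have := wl t; rewrite wt leye_eq.
  have [Vu|Vu] := forall_or_exists_not V u; last first.
    by rewrite (lagrangian_ninfty _ _ wphi)//= leNye.
  move: La Lb; rewrite (lagrangian_fin _ _ w1phi)// (lagrangian_fin _ _ w2phi)//.
  rewrite (lagrangian_fin _ _ wphi)// !lee_fin /lagrangian_real.
  set c := \sum_t (_ - _).
  have phile : \sum_t phi t <= l * \sum_t phi1 t + (1 - l) * \sum_t phi2 t.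
    rewrite !mulr_sumr -big_split ler_sum//= => t _.
    by rewrite -lee_fin -wphi.
  have -> : \sum_t dot (y t) (map_residual (l *: w1 + (1 - l) *: w2)
      (l *: x1 + (1 - l) *: x2) t) = l * (\sum_t dot (y t) (map_residual w1 x1 t)) +
      (1 - l) * \sum_t dot (y t) (map_residual w2 x2 t).
    rewrite !mulr_sumr -big_split; apply: eq_bigr => t _ /=.
    by rewrite map_residual_conv dotDr !dotZr.
  have -> : \sum_t dot (u t) (H t *m (l *: x1 + (1 - l) *: x2) t) =
      l * (\sum_t dot (u t) (H t *m x1 t)) +
      (1 - l) * \sum_t dot (u t) (H t *m x2 t).
    rewrite !mulr_sumr -big_split; apply: eq_bigr => t _ /=.
    by rewrite mulmxDr -!scalemxAr dotDr !dotZr.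
  case/andP: l01 => l0 l1; nra.
move=> [u1 y1] [u2 y2] a b l l01 _ _ La Lb; split => //.
have [wt|[phi wphi]] := monitoring_dichotomy w.
  by rewrite lagrangian_pinfty//= leNye.
have Vfin u y c : (- L (w, x) (u, y) <= c%:E)%E -> forall t, V t (u t).
  have [//|Vu] := forall_or_exists_not V u.
  by rewrite (lagrangian_ninfty _ _ wphi).
have Vu1 := Vfin _ _ _ La; have Vu2 := Vfin _ _ _ Lb.
have Vu t : V t ((l *: u1 + (1 - l) *: u2) t) by exact: polyhedral_convex.
move: La Lb; rewrite !(lagrangian_fin _ _ wphi)// -!EFinN !lee_fin /lagrangian_real.
have rew : l * \sum_t (dot (z t) (u1 t) - 2^-1 * quad (N t) (u1 t)) +
    (1 - l) * \sum_t (dot (z t) (u2 t) - 2^-1 * quad (N t) (u2 t)) <=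
    \sum_t (dot (z t) ((l *: u1 + (1 - l) *: u2) t) -
      2^-1 * quad (N t) ((l *: u1 + (1 - l) *: u2) t)).
  rewrite !mulr_sumr -big_split ler_sum//= => t _.
  have := quad_convex (u1 t) (u2 t) (psdN t) l01.
  rewrite dotDr !dotZr; lra.
have -> : \sum_t dot ((l *: y1 + (1 - l) *: y2) t) (map_residual w x t) =
    l * (\sum_t dot (y1 t) (map_residual w x t)) +
    (1 - l) * \sum_t dot (y2 t) (map_residual w x t).
  rewrite !mulr_sumr -big_split; apply: eq_bigr => t _ /=.
  by rewrite dotDl !dotZl.
have -> : \sum_t dot ((l *: u1 + (1 - l) *: u2) t) (H t *m x t) =
    l * (\sum_t dot (u1 t) (H t *m x t)) +
    (1 - l) * \sum_t dot (u2 t) (H t *m x t).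
  rewrite !mulr_sumr -big_split; apply: eq_bigr => t _ /=.
  by rewrite dotDl !dotZl.
case/andP: l01 => l0 l1; nra.
Qed.

Lemma sum_dot_gt0 n (r : 'I_T.+1 -> 'cV[R]_n) :
  (exists t, r t <> 0) -> 0 < \sum_t dot (r t) (r t).
Proof.
move=> [t rt]; rewrite (bigD1 t)//= ltr_pwDl ?dot_gt0//.
by apply: sumr_ge0 => i _; exact: dot_ge0.
Qed.

Lemma map_cost_gtNy w x : (-oo < map_cost M N W V H z (w, x))%E.
Proof.
rewrite /map_cost ltNye adde_eq_ninfty negb_or; apply/andP; split.
  apply/eqP => /esum_eqNyP [t [_ _ tNy]].
  by have := monitoring_gtNy (M t) (w t) (W_neq0 t); rewrite tNy.
apply/eqP => /esum_eqNyP [t [_ _ tNy]].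
by have := monitoring_gtNy (N t) (z t - H t *m x t) (V_neq0 t); rewrite tNy.
Qed.

Lemma map_cost_pinfty w x :
  (exists t, monitoring (W t) (M t) (w t) = +oo%E) ->
  map_cost M N W V H z (w, x) = +oo%E.
Proof.
move=> [t wt]; have := map_cost_gtNy w x; rewrite /map_cost.
have -> : (\sum_t monitoring (W t) (M t) (w t) = +oo)%E.
  apply/esum_eqyP => [i _|]; last by exists t; rewrite mem_index_enum.
  by rewrite -ltNye monitoring_gtNy.
by case: (\sum_t monitoring (V t) _ _)%E.
Qed.

(** This reduces bounds on the cost to real inequalities. The [W] sum is bounded for each fixed [u],
    then moved to the other side to bound the [V] sum. *)
Lemma map_cost_le w x K :
  (forall y u, (forall t, W t (y t)) -> (forall t, V t (u t)) ->
    \sum_t (dot (w t) (y t) - 2^-1 * quad (M t) (y t)) +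
    \sum_t (dot (z t - H t *m x t) (u t) - 2^-1 * quad (N t) (u t)) <= K) ->
  (map_cost M N W V H z (w, x) <= K%:E)%E.
Proof.
move=> h; have /choice[u0 Vu0] := V_neq0.
have hW u : (forall t, V t (u t)) ->
    (\sum_t monitoring (W t) (M t) (w t) <= (K -
      \sum_t (dot (z t - H t *m x t) (u t) - 2^-1 * quad (N t) (u t)))%:E)%E.
  move=> Vu; apply: sum_monitoring_le => // y Wy.
  by rewrite lerBrDr h.
have := map_cost_gtNy w x; move: (hW u0 Vu0); rewrite /map_cost; move: hW.
case: (\sum_t monitoring (W t) _ _)%E => [r||] hW; rewrite ?leye_eq//.
move=> _ _; rewrite -leeBrDl// -EFinB; apply: sum_monitoring_le => // u /hW.
by rewrite lee_fin; lra.
Qed.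

Lemma sum_measurement x u :
  \sum_t (dot (z t - H t *m x t) (u t) - 2^-1 * quad (N t) (u t)) =
  \sum_t (dot (z t) (u t) - 2^-1 * quad (N t) (u t)) - \sum_t dot (u t) (H t *m x t).
Proof.
rewrite -sumrB; apply: eq_bigr => t _.
by rewrite dotBl (dotC (H t *m x t)); ring.
Qed.

Lemma map_objective_sup p :
  map_objective M N W V F H z p = ereal_sup [set L p q | q in [set: _]].
Proof.
case: p => w x; have /choice[u0 Vu0] := V_neq0; rewrite /map_objective.
have [wt|[phi wphi]] := monitoring_dichotomy w.
  rewrite ereal_supy; last by exists (u0, 0) => //; exact: lagrangian_pinfty.
  by case: ifP => // _; exact: map_cost_pinfty.
case: asboolP => [/map_residualP res0|nres]; last first.
  have [t rt] : exists t, map_residual w x t <> 0.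
    by apply: contrapT => /forallNP r0; apply/nres/map_residualP => t; apply: contrapT (r0 t).
  apply/esym/eq_infty => K.
  have rho0 := sum_dot_gt0 (ex_intro _ t rt).
  set rho := \sum_t _ in rho0.
  pose C := \sum_t phi t + \sum_t (dot (z t) (u0 t) - 2^-1 * quad (N t) (u0 t)) -
    \sum_t dot (u0 t) (H t *m x t).
  (* Taking [y] proportional to the nonzero residual gives [L] the value [C + s * rho = K]. *)
  pose s := (K - C) / rho.
  suff <- : L (w, x) (u0, (fun t => s *: map_residual w x t)) = K%:E.
    by apply: ereal_sup_ubound; eexists.
  rewrite (lagrangian_fin _ _ wphi)//; congr EFin.
  have -> : K = C + s * rho by rewrite divfK ?gt_eqF//; ring.
  rewrite /lagrangian_real addrCA addrC /C /rho mulr_sumr; congr (_ + _).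
  by apply: eq_bigr => i _; rewrite dotZl.
have LE phi' u y : (forall t, monitoring (W t) (M t) (w t) = (phi' t)%:E) ->
    (forall t, V t (u t)) -> L (w, x) (u, y) = (\sum_t phi' t +
      \sum_t (dot (z t - H t *m x t) (u t) - 2^-1 * quad (N t) (u t)))%:E.
  move=> wphi' Vu; rewrite (lagrangian_fin _ _ wphi')// /lagrangian_real.
  have -> : \sum_t dot (y t) (map_residual w x t) = 0.
    by apply: big1 => t _; rewrite res0 dot0r.
  by rewrite sum_measurement sub0r addrA.
apply/eqP; rewrite eq_le; apply/andP; split; last first.
  apply: ge_ereal_sup => _ [[u y] _ <-].
  have [Vu|Vu] := forall_or_exists_not V u; last by rewrite (lagrangian_ninfty _ _ wphi) ?leNye.
  rewrite (LE phi)// EFinD -!sumEFin leeD// lee_sum// => t _.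
    by rewrite wphi.
  exact: monitoring_ge.
set S := ereal_sup _.
have LS u y : (forall t, V t (u t)) -> (L (w, x) (u, y) <= S)%E.
  by move=> Vu; apply: ereal_sup_ubound; exists (u, y).
have SE : S = +oo%E \/ exists r, S = r%:E.
  have := LS u0 0 Vu0; rewrite (LE phi)//.
  by case: S LS => [r||]; [right; exists r|left|rewrite leeNy_eq].
case: SE => [->|[r Sr]]; first by rewrite leey.
(* With zero residual the Lagrangian ignores its own [y], taken to be 0; the [y] here is the
   variable maximized in the monitoring functions of [W]. *)
rewrite Sr; apply: map_cost_le => y u Wy Vu.
have := LS u 0 Vu; rewrite (LE phi)// Sr lee_fin; apply: le_trans.
rewrite lerD2r ler_sum// => t _; rewrite -lee_fin -wphi; exact: monitoring_ge.
Qed.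

Lemma control_objective_inf q :
  control_objective M N W V F H z q = ereal_inf [set L p q | p in [set: _]].
Proof.
case: q => u y; have /choice[y0 Wy0] := W_neq0; rewrite /control_objective.
(* A base point with finite monitoring values, where [L] cannot be [+oo]. *)
pose w0 t := M t *m y0 t.
have w0phi t : monitoring (W t) (M t) (w0 t) = (2^-1 * quad (M t) (y0 t))%:E.
  exact: monitoring_mul.
have [Vu|Vu] := forall_or_exists_not V u; last first.
  rewrite asboolF; last first.
    by move=> /control_residualP[_ WV]; case: Vu => t []; have [] := WV t.
  apply/esym/eqP; rewrite -leeNy_eq; apply: ereal_inf_lbound.
  by exists (w0, 0) => //; exact: lagrangian_ninfty w0phi Vu.
have LE phi w x : (forall t, monitoring (W t) (M t) (w t) = (phi t)%:E) ->
    L (w, x) (u, y) = (\sum_t (dot (z t) (u t) - 2^-1 * quad (N t) (u t)) +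
      \sum_t (phi t - dot (y t) (w t)) +
      \sum_t dot (x t) (control_residual u y t))%:E.
  move=> wphi; rewrite (lagrangian_fin _ _ wphi)// /lagrangian_real.
  by rewrite residual_duality !sumrB; congr EFin; ring.
have [res0|[t rt]] := forall_or_exists_not (fun t => [set r | r = 0]) (control_residual u y);
    last first.
  case: asboolP => [/control_residualP[/(_ t)//]|_].
  apply/esym/eq_ninfty => K.
  have rho0 := sum_dot_gt0 (ex_intro _ t rt); set rho := \sum_t _ in rho0.
  set C := \sum_t (dot (z t) (u t) - 2^-1 * quad (N t) (u t)) +
      \sum_t (2^-1 * quad (M t) (y0 t) - dot (y t) (w0 t)).
  pose s := (K - C) / rho.
  suff <- : L (w0, fun t => s *: control_residual u y t) (u, y) = K%:E.
    by apply: ereal_inf_lbound; eexists.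
  rewrite (LE _ _ _ w0phi) -/C; congr EFin.
  have -> : K = C + s * rho by rewrite divfK ?gt_eqF//; ring.
  by congr (_ + _); rewrite /rho mulr_sumr; apply: eq_bigr => i _; rewrite dotZl.
have {}LE phi w x : (forall t, monitoring (W t) (M t) (w t) = (phi t)%:E) ->
    L (w, x) (u, y) = (\sum_t (dot (z t) (u t) - 2^-1 * quad (N t) (u t)) +
      \sum_t (phi t - dot (y t) (w t)))%:E.
  by move=> /LE ->; rewrite [X in _ + X]big1 ?addr0// => t _; rewrite res0 dot0r.
have [Wy|[t0 Wyt0]] := forall_or_exists_not W y; last first.
  case: asboolP => [/control_residualP[_ /(_ t0)[]//]|_].
  apply/esym/eq_ninfty => K.
  set C := \sum_t (dot (z t) (u t) - 2^-1 * quad (N t) (u t)) in LE.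
  (* Where [y t] lies in [W t], the point [M t *m y t] contributes at most 0; elsewhere the
     contribution can be pushed below any bound, here [K - C] at [t0] and 0 at other times. *)
  have /choice[wm wmP] t : exists wm : 'cV[R]_nx * R,
      monitoring (W t) (M t) wm.1 = wm.2%:E /\
      wm.2 - dot (y t) wm.1 <= if t == t0 then K - C else 0.
    have [Wyt|Wyt] := pselect (W t (y t)).
      exists (M t *m y t, 2^-1 * quad (M t) (y t)); split; first exact: monitoring_mul.
      have -> : t == t0 = false by apply/eqP => tt0; apply: Wyt0; rewrite -tt0.
      by rewrite /= -/(quad (M t) (y t)); have := (psdM t).2 (y t); lra.
    have [v [m [vm Km]]] := monitoring_conjugate_unbounded
      (- if t == t0 then K - C else 0) (psdM t) (polyW t) (W_neq0 t) Wyt.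
    by exists (v, m); split => //=; move: Km; rewrite dotC; case: eqP => _; lra.
  apply: (@le_trans _ _ (L (fun t => (wm t).1, 0) (u, y))).
    by apply: ereal_inf_lbound; eexists.
  rewrite (LE (fun t => (wm t).2)) => [|t]; last by have [] := wmP t.
  rewrite lee_fin addrC -lerBrDr.
  apply: (@le_trans _ _ (\sum_t if t == t0 then K - C else 0)).
    by apply: ler_sum => t _; have [] := wmP t.
  by rewrite -big_mkcond big_pred1_eq.
case: asboolP => [_|nc]; last first.
  by exfalso; apply: nc; apply/control_residualP; split.
have rewardE : control_reward M N z (u, y) =
    \sum_t (dot (z t) (u t) - 2^-1 * quad (N t) (u t)) +
    \sum_t (- (2^-1 * quad (M t) (y t))).
  by rewrite -big_split; apply: eq_bigr => t _; rewrite /=; ring.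
apply/eqP; rewrite eq_le rewardE; apply/andP; split.
  apply: le_ereal_inf_tmp => _ [[w x] _ <-].
  have [wt|[phi wphi]] := monitoring_dichotomy w.
    by rewrite lagrangian_pinfty ?leey.
  rewrite (LE _ _ _ wphi) lee_fin lerD2l ler_sum// => t _.
  have := monitoring_ge (M t) (w t) (Wy t); rewrite wphi lee_fin dotC; lra.
apply: ereal_inf_lbound; exists ((fun t => M t *m y t), 0) => //.
rewrite (LE (fun t => 2^-1 * quad (M t) (y t))) => [|t]; last exact: monitoring_mul.
congr EFin; congr (_ + _); apply: eq_bigr => t _.
by rewrite -/(quad (M t) (y t)); lra.
Qed.

Lemma lagrangian_dual : dual_via setT setT
  (map_objective M N W V F H z) (control_objective M N W V F H z) L.
Proof.
split; first exact: lagrangian_convex_concave.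
- by move=> p _; exact: map_objective_sup.
- by move=> q _; exact: control_objective_inf.
Qed.

Lemma weak_duality : (control_value M N W V F H z <= map_value M N W V F H z)%E.
Proof.
apply: ge_ereal_sup => _ [q _ <-]; apply: le_ereal_inf_tmp => _ [p _ <-].
rewrite map_objective_sup control_objective_inf.
apply: (@le_trans _ _ (L p q)); first by apply: ereal_inf_lbound; exists p.
by apply: ereal_sup_ubound; exists q.
Qed.

(** [S t] and [U t] are coordinate projections of one long vector, so that the quadratic program
    over a single vector covers all times at once. *)
Lemma stacking : exists n (S : 'I_T.+1 -> 'M[R]_(nx, n)) (U : 'I_T.+1 -> 'M[R]_(nz, n)),
  forall y u, exists xi : 'cV_n, forall t, S t *m xi = y t /\ U t *m xi = u t.
Proof.
pose K : finType := ('I_T.+1 * ('I_nx + 'I_nz))%type.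
exists #|K|, (fun t => \matrix_(i, k) (k == enum_rank ((t, inl i) : K))%:R),
  (fun t => \matrix_(i, k) (k == enum_rank ((t, inr i) : K))%:R) => y u.
exists (\col_k let: (t, s) := enum_val k in
  match s with inl i => y t i 0 | inr i => u t i 0 end).
have sumE (g : 'I_#|K| -> R) k0 : \sum_k (k == k0)%:R * g k = g k0.
  rewrite (bigD1 k0)//= eqxx mul1r big1 ?addr0// => k /negbTE ->.
  by rewrite mul0r.
move=> t; split; apply/colP => i; rewrite !mxE.
  under eq_bigr do rewrite !mxE.
  by rewrite (sumE (fun k => let: (t, s) := enum_val k in _)) enum_rankK.
under eq_bigr do rewrite !mxE.
by rewrite (sumE (fun k => let: (t, s) := enum_val k in _)) enum_rankK.
Qed.

Lemma polyhedral_family m n (X : 'I_T.+1 -> set 'cV[R]_m) (S : 'I_T.+1 -> 'M[R]_(m, n)) :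
  (forall t, polyhedral (X t)) ->
  exists (I : finType) (a : I -> 'cV[R]_n) (b : I -> R), forall xi,
    (forall i, dot (a i) xi <= b i) <-> (forall t, X t (S t *m xi)).
Proof.
move=> polyX.
have /choice[D DP] t : exists D : {k : nat & ('M[R]_(k, m) * 'cV[R]_k)%type},
    X t = [set u | forall i, ((tagged D).1 *m u) i 0 <= (tagged D).2 i 0].
  by have [k [A [b ->]]] := polyX t; exists (existT _ k (A, b)).
pose I : finType := {t : 'I_T.+1 & 'I_(tag (D t))}.
exists I, (fun i => (row (tagged i) ((tagged (D (tag i))).1 *m S (tag i)))^T),
  (fun i => (tagged (D (tag i))).2 (tagged i) 0) => xi.
have rowE (i : I) : dot (row (tagged i) ((tagged (D (tag i))).1 *m S (tag i)))^T xi =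
    ((tagged (D (tag i))).1 *m (S (tag i) *m xi)) (tagged i) 0.
  by rewrite /dot trmxK -row_mul mxE mulmxA.
split=> h; last by move=> i; rewrite rowE; have := h (tag i); rewrite DP; apply.
by move=> t; rewrite DP => i; have := h (existT _ t i); rewrite rowE.
Qed.

(* The multipliers of the adjoint dynamics are the optimal states. *)
Lemma control_strong_duality :
  control_feasible W V F H -> (control_value M N W V F H z < +oo)%E ->
  exists w x u y, [/\ map_constraints F (w, x), control_constraints W V F H (u, y) &
    (map_cost M N W V H z (w, x) <= (control_reward M N z (u, y))%:E)%E].
Proof.
move=> [[u0 y0] q0] vlty.
have [n [S [U SU]]] := stacking.
have [I [a [b abP]]] := polyhedral_family S polyW.
have [J [a' [b' abP']]] := polyhedral_family U polyV.
pose G t := S t - (H t)^T *m U t -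
  (if unlift ord_max t is Some j then (F j)^T *m S (time_succ j) else 0).
pose Y (xi : 'cV_n) t := S t *m xi; pose Z (xi : 'cV_n) t := U t *m xi.
have GE xi t : G t *m xi = control_residual (Z xi) (Y xi) t.
  rewrite /G /control_residual /Y /Z !mulmxBl -mulmxA.
  by case: (unlift _ _) => [j|]; rewrite ?mulmxA ?mul0mx.
pose Q := \sum_t ((S t)^T *m M t *m S t + (U t)^T *m N t *m U t).
pose c := \sum_t (U t)^T *m z t.
have quadQ xi : quad Q xi = \sum_t (quad (M t) (Y xi t) + quad (N t) (Z xi t)).
  rewrite /quad /Q mulmx_suml dot_sumr; apply: eq_bigr => t _.
  by rewrite mulmxDl dotDr -!mulmxA dot_mulr trmxK [X in _ + X]dot_mulr trmxK.
have psdQ : psd Q.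
  split=> [|xi]; last first.
    by rewrite quadQ sumr_ge0// => t _; rewrite addr_ge0// ?(psdM t).2// (psdN t).2.
  rewrite /Q linear_sum; apply: eq_bigr => t _.
  by rewrite linearD/= !trmx_mul !trmxK (psdM t).1 (psdN t).1 !mulmxA.
have objE xi : qobj Q c xi = control_reward M N z (Z xi, Y xi).
  rewrite /qobj quadQ /c dotC dot_sumr mulr_sumr -sumrB; apply: eq_bigr => t _.
  by rewrite dot_mulr trmxK dotC; ring.
pose ab (k : I + J) := match k with inl i => a i | inr j => a' j end.
pose bb (k : I + J) := match k with inl i => b i | inr j => b' j end.
pose g (k : 'I_T.+1 * 'I_nx) := (row k.2 (G k.1))^T.
have gE k xi : dot (g k) xi = control_residual (Z xi) (Y xi) k.1 k.2 0.
  by rewrite -GE /g /dot trmxK -row_mul mxE.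
have abE xi : (forall k, dot (ab k) xi <= bb k) <->
    (forall t, W t (Y xi t) /\ V t (Z xi t)).
  split=> [h t|h].
    split; first exact: (abP xi).1 (fun i => h (inl i)) t.
    exact: (abP' xi).1 (fun i => h (inr i)) t.
  case=> i /=.
    by apply: (abP xi).2 => t; have [] := h t.
  by apply: (abP' xi).2 => t; have [] := h t.
have feasE xi : (forall k, dot (ab k) xi <= bb k) /\ (forall k, dot (g k) xi = 0) <->
    control_constraints W V F H (Z xi, Y xi).
  rewrite control_residualP abE; split=> -[h1 h2]; split=> //.
    by move=> t; apply/colP => i; rewrite [RHS]mxE -(gE (t, i)).
  by move=> k; rewrite gE h1 mxE.
have v0 : ((control_reward M N z (u0, y0))%:E <= control_value M N W V F H z)%E.
  by apply: ereal_sup_ubound; exists (u0, y0) => //; rewrite /control_objective asboolT.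
have [K vK] : exists K, control_value M N W V F H z = K%:E.
  move: v0 vlty; case: (control_value M N W V F H z) => [K||]; first by exists K.
  - by rewrite ltxx.
  - by rewrite leeNy_eq.
have [||xi [l [/feasE Fxi ximax]]] := @qobj_strong_duality R n Q c _ _ ab bb g K psdQ.
- have [xi0 xi0P] := SU y0 u0; exists xi0; apply/feasE.
  have -> : Z xi0 = u0 by apply/funext => t; have [] := xi0P t.
  by have -> : Y xi0 = y0 by apply/funext => t; have [] := xi0P t.
- move=> xi /feasE Fxi; rewrite objE -lee_fin -vK.
  apply: ereal_sup_ubound; exists (Z xi, Y xi) => //.
  by rewrite /control_objective asboolT.
pose x (t : 'I_T.+1) : 'cV[R]_nx := \col_i l (t, i).
(* The multipliers are unrestricted, so [x] may be any trajectory; defining [w] from it makes the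
   dynamics hold. *)
pose w (t : 'I_T.+1) : 'cV[R]_nx := x t -
  (if unlift ord0 t is Some j then F j *m x (time_cur j) else 0).
have res0 t : map_residual w x t = 0.
  by rewrite /map_residual /w opprB addrCA subrr addr0 subrr.
exists w, x, (Z xi), (Y xi); split=> //; first exact/map_residualP.
(* These [y] and [u] need not satisfy the adjoint dynamics. Since the residual of [(w, x)] is zero,
   [residual_duality] identifies the required inequality with [ximax] at the stacked point. *)
apply: map_cost_le => y u Wy Vu.
have [zeta zetaP] := SU y u.
have ZE : Z zeta = u by apply/funext => t; have [] := zetaP t.
have YE : Y zeta = y by apply/funext => t; have [] := zetaP t.
have := ximax zeta; rewrite abE ZE YE => /(_ (fun t => conj (Wy t) (Vu t))).
rewrite !objE ZE YE; apply: le_trans.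
have -> : \sum_j l j * dot (g j) zeta = \sum_t dot (x t) (control_residual u y t).
  under [RHS]eq_bigr do rewrite dotE.
  rewrite pair_big; apply: eq_bigr => -[t i] _ /=.
  by rewrite gE /= ZE YE [x t i 0]mxE.
have := residual_duality w x u y.
rewrite [X in X - _ = _ -> _]big1 => [|t _]; last by rewrite res0 dot0r.
rewrite sum_measurement /= sub0r => E.
have rewardE : control_reward M N z (u, y) =
    \sum_t (dot (z t) (u t) - 2^-1 * quad (N t) (u t)) -
    \sum_t (2^-1 * quad (M t) (y t)).
  by rewrite -sumrB; apply: eq_bigr => t _; rewrite /=; ring.
rewrite -[X in _ <= X + _]/(control_reward M N z (u, y)) rewardE.
have -> : \sum_t (dot (w t) (y t) - 2^-1 * quad (M t) (y t)) =
    \sum_t dot (y t) (w t) - \sum_t (2^-1 * quad (M t) (y t)).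
  by rewrite -sumrB; apply: eq_bigr => t _; rewrite dotC.
lra.
Qed.

Lemma strong_duality : control_feasible W V F H ->
  [/\ map_value M N W V F H z = control_value M N W V F H z,
      map_attained M N W V F H z &
      (control_value M N W V F H z < +oo)%E -> control_attained M N W V F H z].
Proof.
move=> feas; have weak := weak_duality.
have [vlty|] := ltP (control_value M N W V F H z) +oo%E; last first.
  rewrite leye_eq => /eqP vy; move: weak; rewrite vy leye_eq => /eqP mvy.
  (* The estimation value is [+oo], so every admissible point attains it, the zero trajectory among
     them. *)
  split=> //; exists (0, 0).
    by split=> [t|//]; rewrite mulmx0 addr0.
  apply/eqP; rewrite mvy -leye_eq -mvy; apply: ereal_inf_lbound.
  exists (0, 0) => //; rewrite /map_objective asboolT//.
  by split=> [t|//]; rewrite mulmx0 addr0.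
have [w [x [u [y [pC qC le]]]]] := control_strong_duality feas vlty.
have mv : (map_value M N W V F H z <= map_cost M N W V H z (w, x))%E.
  by apply: ereal_inf_lbound; exists (w, x) => //; rewrite /map_objective asboolT.
have cv : ((control_reward M N z (u, y))%:E <= control_value M N W V F H z)%E.
  by apply: ereal_sup_ubound; exists (u, y) => //; rewrite /control_objective asboolT.
have mvE : map_value M N W V F H z = control_value M N W V F H z.
  by apply/eqP; rewrite eq_le weak (le_trans mv)// (le_trans le).
split=> //.
  by exists (w, x) => //; apply/eqP; rewrite eq_le mv andbT mvE (le_trans le).
move=> _; exists (u, y) => //; apply/eqP; rewrite eq_le cv /=.
by rewrite -mvE (le_trans mv).
Qed.

End LagrangianDuality.

Theorem corollary2p9 (R : realType) (T nx nz : nat)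
    (M : 'I_T.+1 -> 'M[R]_nx) (N : 'I_T.+1 -> 'M[R]_nz)
    (W : 'I_T.+1 -> set 'cV[R]_nx) (V : 'I_T.+1 -> set 'cV[R]_nz)
    (F : 'I_T -> 'M[R]_nx) (H : 'I_T.+1 -> 'M[R]_(nz, nx))
    (z : 'I_T.+1 -> 'cV[R]_nz)
    (d : measure_display) (Omega : measurableType d) (P : probability Omega R)
    (rW : 'I_T.+1 -> {RV P >-> nx.-tuple (measurableTypeR R)})
    (rV : 'I_T.+1 -> {RV P >-> nz.-tuple (measurableTypeR R)})
    (psdM : forall t, psd (M t)) (psdN : forall t, psd (N t))
    (polyW : forall t, polyhedral (W t)) (polyV : forall t, polyhedral (V t))
    (W_neq0 : forall t, W t !=set0) (V_neq0 : forall t, V t !=set0)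
    (indep : independent_vectors rW rV)
    (densW : forall t, density_proportional_to (rW t)
       (fun w => expeR (- monitoring (W t) (M t) w)%E))
    (densV : forall t, density_proportional_to (rV t)
       (fun v => expeR (- monitoring (V t) (N t) v)%E)) :
  [/\ dual_via [set: trajectory nx * trajectory nx]
        [set: trajectory nz * trajectory nx]
        (map_objective M N W V F H z) (control_objective M N W V F H z)
        (lagrangian M N W V F H z),
      map_feasible M N W V F H z ->
        [/\ map_value M N W V F H z = control_value M N W V F H z,
            map_attained M N W V F H z & control_attained M N W V F H z] &
      control_feasible W V F H ->
        [/\ map_value M N W V F H z = control_value M N W V F H z,
            map_attained M N W V F H z &
            (control_value M N W V F H z < +oo)%E ->
              control_attained M N W V F H z]].
Proof.
have W0 t : W t 0 := density_monitoring0 (polyW t) (densW t).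
have V0 t : V t 0 := density_monitoring0 (polyV t) (densV t).
have feas : control_feasible W V F H.
  by exists (0, 0); split=> [t||t]; rewrite ?mulmx0 ?addr0.
split=> [|[p pC pfin]|_]; first exact: lagrangian_dual.
- have [mvE mA cA] := strong_duality z psdM psdN polyW polyV W_neq0 V_neq0 feas.
  split => //; apply: cA; rewrite -mvE.
  apply: (@le_lt_trans _ _ (map_cost M N W V H z p)); last by rewrite ltey_eq pfin.
  by apply: ereal_inf_lbound; exists p => //; rewrite /map_objective asboolT.
- exact: strong_duality.
Qed.
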